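(* Let $\mathcal G=(V,\mathcal E,\mathcal L,\mathcal S)$ be a liftable smDG. Suppose that $\mathcal G$ contains an edge $a\to b$ such that $a$ is an element of some $V_s\in\mathcal S$ and $b$ is an element of some $V_m\in\mathcal L$. Further suppose that $a$ and $b$ belong to the same face of the marginalized independence system, that is, that $a$ is also an element of $V_m$. Then $\mathcal G$ is observationally equivalent to the smDG $\mathcal G'$ obtained by starting from $\mathcal G$ and removing the edge $a\to b$.
   Context: **smDG.** An independence system over a finite set $V$ is a collection of subsets of $V$ (faces) containing $\emptyset$ and closed under subsets; a face is maximal if not strictly contained in another. An smDG is a quadruple $(V,\mathcal E,\mathcal L,\mathcal S)$ with $(V,\mathcal E)$ a directed graph (cycles and self-loops allowed) and $\mathcal L$ (marginalized), $\mathcal S$ (selected) independence systems over $V$. **Canonical graph, liftable.** $\mathrm{can}(\mathcal G)$ is obtained from $(V,\emptyset)$ by: (1) for each $a\to b\in\mathcal E$ where $a$ lies in some face of $\mathcal S$ and $b$ lies in some face of $\mathcal L$, adding a marginalized vertex $m_{ab}$, a selected vertex $s_{ab}$ and a path $a\to s_{ab}\leftarrow m_{ab}\to b$; (2) for each other $a\to b\in\mathcal E$, adding the edge $a\to b$; (3) for each maximal face of $\mathcal L$, adding a marginalized vertex with edges to every vertex of the face; (4) for each maximal face of $\mathcal S$, adding a selected vertex with edges from every vertex of the face. $\mathcal G$ is liftable if $\mathrm{can}(\mathcal G)$ is acyclic. **Observational equivalence.** For a DAG $\mathcal D$ with vertices partitioned as $(V,M,S)$ (visible, marginalized, selected), each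 vertex $w$ carries a random variable $X_w$ on a (discrete or standard Borel) state space; state spaces are not prescribed by the graph and are part of the choice of model. A distribution $P$ is Markov relative to $\mathcal D$ if $P(x_W)=\prod_{w\in W}P(x_w\mid x_{\mathrm{pa}(w)})$, $W=V\sqcup M\sqcup S$; a kernel $P(x_w\mid x_{\mathrm{pa}(w)})$ is deterministic if $x_w$ is a deterministic function of the parents' values. The SMO model $\mathcal M(\mathcal D,V\mid S)$ is the set of all distributions of $X_V$ obtained from some $P(X_{V\sqcup M\sqcup S})$ that is Markov relative to $\mathcal D$ and in which all visible variables have deterministic kernels, by marginalizing $X_M$ and conditioning (regular conditional probability) on $X_S=\vec 0$; cases where the density of $X_S$ at $\vec 0$ is zero are excluded. Two liftable smDGs $\mathcal G,\mathcal G'$ on $V$ are observationally equivalent if $\mathcal M(\mathrm{can}(\mathcal G),V\mid S)=\mathcal M(\mathrm{can}(\mathcal G'),V\mid S')$, where $S,S'$ are the sets of selected vertices of $\mathrm{can}(\mathcal G),\mathrm{can}(\mathcal G')$.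
   Formalization: ''Density of X_S at 0 is nonzero'' is taken as P(X_S=0)>0; for continuous selected variables the regular conditional probability at the single point 0 is not determined, and with unbounded densities the claim fails. *)

(* Defs.v *)
From HB Require Import structures.
From mathcomp Require Import all_boot all_order all_algebra.
From mathcomp Require Import all_classical all_reals all_analysis.

Set Implicit Arguments.
Unset Strict Implicit.
Unset Printing Implicit Defensive.

Import Order.TTheory GRing.Theory Num.Theory.
Import numFieldNormedType.Exports.

Local Open Scope classical_set_scope.
Local Open Scope ring_scope.

Record indep_system (V : finType) := IndepSystem {
  faces :> {set {set V}};
  set0_face : finset.set0 \in faces;
  face_subset : forall A B : {set V}, A \subset B -> B \in faces -> A \in faces
}.

Definition maximal_face (V : finType) (I : indep_system V) (F : {set V}) : bool :=
  maxset (fun A : {set V} => A \in faces I) F.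

Record smDG (V : finType) := SmDG {
  edges : {set V * V};
  marg : indep_system V;
  sel : indep_system V
}.

Definition remove_edge (V : finType) (G : smDG V) (e : V * V) : smDG V :=
  SmDG (edges G :\ e) (marg G) (sel G).

Record lsgraph (V : finType) := LSGraph {
  mvert : finType;
  svert : finType;
  arrow : rel (V + mvert + svert)%type
}.

Arguments arrow {V} _.

Definition vertex (V : finType) (D : lsgraph V) : finType :=
  (V + mvert D + svert D)%type.

Notation Visible v := (inl (inl v)) (only parsing).
Notation Marginalized m := (inl (inr m)) (only parsing).
Notation Selected s := (inr s) (only parsing).

(* Self-loops count as cycles: [cycle e [:: x]] is [e x x]. *)
Definition acyclic (T : Type) (e : rel T) : Prop :=
  forall c : seq T, path.cycle e c -> c = [::].

Section Canonical.
Variables (V : finType) (G : smDG V).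

Definition special (e : V * V) : bool :=
  [&& e \in edges G, e.1 \in finset.cover (sel G) & e.2 \in finset.cover (marg G)].

Definition can_mvert : finType :=
  ({e : V * V | special e} + {F : {set V} | maximal_face (marg G) F})%type.

Definition can_svert : finType :=
  ({e : V * V | special e} + {F : {set V} | maximal_face (sel G) F})%type.

Definition can_arrow : rel (V + can_mvert + can_svert)%type := fun u w =>
  match u, w with
  | Visible a, Visible b => ((a, b) \in edges G) && ~~ special (a, b)
  | Visible a, Selected (inl e) => a == (val e).1
  | Marginalized (inl e), Selected (inl e') => e == e'
  | Marginalized (inl e), Visible b => b == (val e).2
  | Marginalized (inr F), Visible b => b \in val F
  | Visible a, Selected (inr F) => a \in val F
  | _, _ => false
  end.

Definition can : lsgraph V := LSGraph can_arrow.

Definition liftable : Prop := acyclic (arrow can).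

End Canonical.

(* Every standard Borel space is Borel isomorphic to a Borel subset of the
   reals, so random variables are real valued and a state space is a subset of
   [R].  The law of [X_V] is then a law on [R^V]: it does not record the state
   spaces, which may differ between two models of the same law. *)
Inductive space_kind := Discrete | StandardBorel.

Definition state_space (R : realType) (k : space_kind) (Omega : set R) : Prop :=
  match k with
  | Discrete => countable Omega
  | StandardBorel => measurable Omega
  end.

Section Config.
Variables (R : realType) (I : finType).

Definition cylinders : set (set (I -> R)) :=
  [set C | exists (i : I) (B : set R), measurable B /\ C = [set x | B (x i)]].

(* [I -> R] with the product sigma-algebra. *)
Definition config := g_sigma_algebraType cylinders.

End Config.

Section Model.
Variables (R : realType) (V : finType) (D : lsgraph V).

Local Notation W := (vertex D).
Local Notation "u --> w" := (arrow D u w) (at level 70).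

Definition topological_order (s : seq W) : Prop :=
  [/\ uniq s, s =i W & forall u w : W, u --> w -> (index u s < index w s)%N].

(* A kernel P(x_w | x_pa(w)) is a kernel out of [R^W] that only looks at the
   coordinates in pa(w).  Its values off the state spaces of the parents are
   immaterial, so conditions on kernels can be imposed at every point. *)
Definition parental (w : W) (k : R.-pker (config R W) ~> R) : Prop :=
  forall x y : config R W,
    (forall u, u --> w -> x u = y u) -> forall B, measurable B -> k x B = k y B.

Definition deterministic (k : R.-pker (config R W) ~> R) : Prop :=
  exists f : config R W -> R,
    forall x (B : set R), measurable B -> k x B = \d_(f x) B.

(* For [s = w1 :: ... :: wn] this is the iterated integral
   int P(dx_w1 | .) ... int P(dx_wn | .) F(x), the coordinates outside [s]
   being those of the last argument. *)
Fixpoint iterated_integral (k : W -> R.-pker (config R W) ~> R) (s : seq W)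
    (F : config R W -> \bar R) (x : config R W) : \bar R :=
  if s is w :: s' then
    (\int[k w x]_y iterated_integral k s' F [eta x with w |-> y])%E
  else F x.

(* P(dx_W) = prod_w P(dx_w | x_pa(w)).  The base point [fun=> 0] plays no role:
   each coordinate is overwritten before a kernel or the event reads it. *)
Definition markov_factorization (k : W -> R.-pker (config R W) ~> R)
    (P : probability (config R W) R) : Prop :=
  (forall w, parental w (k w)) /\
  exists2 s : seq W, topological_order s &
    forall A, measurable A ->
      P A = iterated_integral k s (fun x => (\1_A x)%:E) (fun=> 0).

Definition visible_part (x : config R W) : config R V :=
  fun v => x (Visible v).

Definition selected_part (x : config R W) : config R (svert D) :=
  fun s => x (Selected s).

(* [K y A] is a version of P(X_V in A | X_S = y). *)
Definition regular_conditional (P : probability (config R W) R)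
    (K : R.-pker (config R (svert D)) ~> (config R V)) : Prop :=
  forall (A : set (config R V)) (B : set (config R (svert D))),
    measurable A -> measurable B ->
    P (visible_part @^-1` A `&` selected_part @^-1` B) =
    (\int[P]_(x in selected_part @^-1` B) K (selected_part x) A)%E.

(* A regular conditional probability is determined up to a null set of values
   of X_S, hence is meaningful at 0 because X_S = 0 is required to have
   positive mass. *)
Definition smo_model (kind : space_kind) : set (probability (config R V) R) :=
  [set Q | exists (Omega : W -> set R) (k : W -> R.-pker (config R W) ~> R)
             (P : probability (config R W) R)
             (K : R.-pker (config R (svert D)) ~> (config R V)),
    [/\ (forall w, state_space kind (Omega w)) /\
          (forall w x, k w x (Omega w) = 1%E),
        markov_factorization k P,
        forall v : V, deterministic (k (Visible v)),
        (0 < P [set x | forall s : svert D, x (Selected s) = 0%R])%E &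
        regular_conditional P K /\
          (forall A, measurable A -> Q A = K (fun=> 0) A)]].

End Model.

Definition observationally_equivalent (R : realType) (kind : space_kind)
    (V : finType) (G G' : smDG V) : Prop :=
  [/\ liftable G, liftable G' &
      smo_model (R := R) (can G) kind = smo_model (R := R) (can G') kind].

(* Main.v *)
Require Import Defs.
From HB Require Import structures.
From mathcomp Require Import all_boot all_order all_algebra.
From mathcomp Require Import all_classical all_reals all_analysis.
From mathcomp Require Import measurable_realfun ring lra.

Set Implicit Arguments.
Unset Strict Implicit.
Unset Printing Implicit Defensive.

Import Order.TTheory GRing.Theory Num.Theory.
Import numFieldNormedType.Exports.

Local Open Scope classical_set_scope.
Local Open Scope ring_scope.

(** Let [e = (a, b)] be the removed edge.  Since [a] is in a selected face and
    [b] in a marginalized one, the canonical graph renders [e] by the path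
    [a -> s_e <- m_e -> b], and removing [e] amounts to deleting the vertices
    [m_e] and [s_e].  A model of the smaller graph is a model of the larger one
    in which the two vertices are constant.

    For the converse, let [m_F] be the marginalized vertex of a maximal face
    [F] that contains both [a] and [b], and [s_F] the selected vertex of a
    maximal face that contains [a].  The variable [m_F], a common parent of [a]
    and [b], can carry besides its old value that of [m_e], which [b] then
    reads off.  What is lost is the selection at [s_e], which keeps a sample
    with a probability [w] that depends on the values of [a] and [m_e].  This
    is replaced by rejection sampling at [a].  The vertex [a] sees its own
    would-be value and [m_e], hence it knows [w]; it must be deterministic, but
    [m_F] can also carry the source of a coin.  If the coin, of bias [w],
    accepts, then [a] takes its old value.  Otherwise it takes an exceptional
    value [c], to which [s_F] responds by leaving the event of selection.  As
    [c] one takes a value that [a] assumes with probability 0, which exists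
    because a law has countably many atoms.

    Three points need work.  Variables are real valued and, in the discrete
    case, have countable state spaces, so the three components of [m_F] are
    packed by a Borel injection of the plane into the line ([encode]), and the
    coin must come from a countable source: the [n]-th binary digit of [w] for
    a geometric [n] ([coin_law]).  Joint laws are iterated integrals along a
    topological order, and Tonelli gives the freedom to choose the order
    ([iterated_move]) while [iterated_recode] compares different graphs.
    Lastly, a model must come with a regular conditional probability given the
    selected variables; turning these variables into bits makes it elementary,
    so that a law belongs to the model if and only if it is proportional to
    the mass of its events within [X_S = 0] ([smo_modelE]).

    The two inclusions are [absorption_expand] and [absorption_reduce], stated
    for any two graphs related as above ([absorption]). *)

(** * Digit expansions *)

Section Digits.
Variable R : realType.
Implicit Types (beta r w : R) (d : nat -> bool).

(** The map underlying the greedy expansion of a number of [[0, 1]] in base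
    [beta] with digits 0 and [beta - 1].  In base 2 every number has such an
    expansion; in base 3 the digits of a number of the Cantor set are unique.
    Both facts are used: base 2 turns reals into bits, base 3 turns bits back
    into a real without ambiguity. *)
Definition shift beta r : R := beta * r - (beta - 1) * (2^-1 <= r)%R%:R.

Definition digit beta r n : bool := 2^-1 <= iter n (shift beta) r.

Definition value beta d : R :=
  fine (\sum_(0 <= n <oo) ((beta - 1) * beta^-1 ^+ n.+1 * (d n)%:R)%:E)%E.

Lemma digitS beta r n : digit beta r n.+1 = digit beta (shift beta r) n.
Proof. by rewrite /digit iterSr. Qed.

Lemma measurable_shift beta : measurable_fun setT (shift beta).
Proof.
apply: measurable_funB; apply: measurable_funM => //.
rewrite (_ : (fun r => _) = fun r : R => if 2^-1 <= r then 1 else 0 : R); last first.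
  by apply/funext => r; case: ifP.
by apply: measurable_fun_ifT => //; exact: measurable_fun_ler.
Qed.

Lemma measurable_digit beta n : measurable_fun setT (digit beta ^~ n).
Proof.
apply: measurable_fun_ler => //; elim: n => [|n IH] /=; first exact: measurable_id.
exact: (measurableT_comp (measurable_shift beta) IH).
Qed.

Section Base.
Variable beta : R.
Hypothesis beta1 : 1 < beta.

Let term d n : R := (beta - 1) * beta^-1 ^+ n.+1 * (d n)%:R.

Let beta0 : 0 < beta. Proof. exact: lt_trans beta1. Qed.

Let coef_ge0 n : 0 <= (beta - 1) * beta^-1 ^+ n.
Proof.
apply: mulr_ge0; first by rewrite subr_ge0 ltW.
by rewrite exprn_ge0// invr_ge0 ltW.
Qed.

Let term_ge0 d n : 0 <= term d n.
Proof. by rewrite mulr_ge0// coef_ge0. Qed.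

Lemma geometric_total :
  (\sum_(0 <= n <oo) ((beta - 1) * beta^-1 ^+ n.+1)%:E)%E = 1%E.
Proof.
have := @cvg_geometric_series R ((beta - 1) * beta^-1) beta^-1.
rewrite ger0_norm ?invr_ge0 ?ltW// invf_lt1// => /(_ beta1) h.
rewrite -[RHS](_ : ((beta - 1) * beta^-1 * (1 - beta^-1)^-1)%:E = 1%E); last first.
  by congr _%:E; field; rewrite subr_eq0 (gt_eqF beta1) gt_eqF.
apply/cvg_lim => //; apply: (@cvg_trans _ (EFin \o series
    (geometric ((beta - 1) * beta^-1) beta^-1) @ \oo)); last first.
  by apply: cvg_comp h _.
apply: near_eq_cvg; near=> n => /=.
rewrite -sumEFin /series/=.
by apply: congr_big => // i _; rewrite exprS mulrA.
Unshelve. all: by end_near. Qed.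

Let evalue_le1 d : (\sum_(0 <= n <oo) (term d n)%:E <= 1)%E.
Proof.
rewrite -geometric_total; apply: lee_nneseries => n _; rewrite lee_fin//.
by rewrite ler_piMr ?coef_ge0//; case: (d n).
Qed.

Let evalue_ge0 d : (0 <= \sum_(0 <= n <oo) (term d n)%:E)%E.
Proof. by apply: nneseries_ge0 => n _ _; rewrite lee_fin. Qed.

Lemma valueE d :
  (value beta d)%:E = (\sum_(0 <= n <oo) ((beta - 1) * beta^-1 ^+ n.+1 * (d n)%:R)%:E)%E.
Proof.
rewrite fineK// ge0_fin_numE ?evalue_ge0//.
by rewrite (le_lt_trans (evalue_le1 d))// ltry.
Qed.

Lemma value_ge0 d : 0 <= value beta d.
Proof. by rewrite -lee_fin valueE evalue_ge0. Qed.

Lemma value_le1 d : value beta d <= 1.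
Proof. by rewrite -lee_fin valueE evalue_le1. Qed.

Lemma valueS d :
  value beta d = ((beta - 1) * (d 0)%:R + value beta (fun n => d n.+1)) / beta.
Proof.
apply: EFin_inj; rewrite valueE nneseries_recl//; last first.
  by move=> n _; rewrite lee_fin term_ge0.
rewrite [in RHS]mulrDl EFinD expr1; congr (_ + _)%E; first by congr _%:E; ring.
rewrite mulrC EFinM valueE -nneseriesZl; last first.
  by move=> n _; rewrite lee_fin (term_ge0 (fun n => d n.+1)).
rewrite -(nneseries_addn 1); last by move=> n; rewrite lee_fin term_ge0.
apply: eq_eseriesr => n _; rewrite addn1 -EFinM [in LHS]exprS; congr _%:E; ring.
Qed.

End Base.

(** One greedy step halves the distance between a number and the value of its
    digits, and this distance is at most 1. *)
Lemma value_digit w : 0 <= w <= 1 -> value 2 (digit 2 w) = w.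
Proof.
have two1 : 1 < 2 :> R by rewrite ltr1n.
have close n : forall v : R, 0 <= v <= 1 -> `|value 2 (digit 2 v) - v| <= 2^-1 ^+ n.
  elim: n => [|n IH] v /andP[v0 v1].
    have := value_ge0 two1 (digit 2 v); have := value_le1 two1 (digit 2 v).
    by rewrite expr0 ler_norml; lra.
  have : 0 <= shift 2 v <= 1.
    by rewrite /shift; case: (leP 2^-1 v) => /= h; rewrite ?mulr1 ?mulr0; apply/andP; split; lra.
  move=> /IH h.
  rewrite (valueS two1) (_ : _ - v =
      (value 2 (digit 2 (shift 2 v)) - shift 2 v) * 2^-1).
    by rewrite normrM exprSr (ger0_norm (_ : 0 <= 2^-1 :> R))// ler_wpM2r.
  rewrite (_ : (fun n => _) = digit 2 (shift 2 v)); last first.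
    by apply/funext => i; rewrite digitS.
  by rewrite /shift /(digit _ _ 0)/=; field.
move=> /close h; apply/eqP; rewrite -subr_eq0 -normr_le0.
have cv : (2^-1 ^+ n : R) @[n --> \oo] --> (0 : R).
  apply: cvg_expr; rewrite ger0_norm//; lra.
rewrite -(cvg_lim _ cv)//; apply: limr_ge; first by apply: cvgP cv.
by near=> n; apply: h.
Unshelve. all: by end_near. Qed.

(** In base 3 the first digit contributes 0 or 2/3 and the later ones at most 1/3,
    so comparing with 1/2 recovers it. *)
Lemma digit_value d : digit 3 (value 3 d) = d.
Proof.
have three1 : 1 < 3 :> R by rewrite ltr1n.
apply/funext => n; elim: n d => [|n IH] d.
  rewrite /digit/= (valueS three1).
  have := value_ge0 three1 (fun n => d n.+1).
  have := value_le1 three1 (fun n => d n.+1).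
  case: (d 0) => /= h1 h0; first by lra.
  apply/negbTE; lra.
rewrite digitS -[RHS](IH (fun n => d n.+1)); congr digit.
rewrite /shift (_ : (2^-1 <= value 3 d) = d 0).
  by rewrite [in LHS](valueS three1 d); field.
have := value_ge0 three1 (fun n => d n.+1).
have := value_le1 three1 (fun n => d n.+1).
rewrite (valueS three1 d).
case: (d 0) => /= h1 h0; first by lra.
apply/negbTE; lra.
Qed.

Lemma measurable_value dT (T : measurableType dT) beta (d : T -> nat -> bool) :
  1 < beta -> (forall n, measurable_fun setT (d ^~ n)) ->
  measurable_fun setT (fun t => value beta (d t)).
Proof.
move=> beta1 md; apply: measurableT_comp => //.
apply: ge0_emeasurable_sum => [n t _ _|n _].
  rewrite lee_fin !mulr_ge0 ?subr_ge0 ?(ltW beta1)// exprn_ge0// invr_ge0.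
  by rewrite (le_trans ler01)// ltW.
apply/measurable_EFinP; apply: measurable_funM => //.
rewrite (_ : (fun _ => _) = fun t => if d t n then 1 else 0 : R); last first.
  by apply/funext => t; case: (d t n).
exact: measurable_fun_ifT.
Qed.

End Digits.

(** * Packing two reals into one, and a coin with a countable source *)

Section UnitMass.
Context d (T : measurableType d) (R : realType) (m : {measure set T -> \bar R}).

Definition unit_mass of m setT = 1%E : set T -> \bar R := m.

Variable m1 : m setT = 1%E.

HB.instance Definition _ := Measure.copy (unit_mass m1) m.
HB.instance Definition _ := Measure_isProbability.Build _ _ _ (unit_mass m1) m1.

End UnitMass.

Section Encoding.
Variable R : realType.
Implicit Types (u v z w : R) (mu nu P : probability R R).

(** An injection of the reals into [[0, 1]] which, like its inverse, is made of
    [expR] and [ln] alone, hence visibly measurable. *)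
Definition squash u : R := expR (- expR u).

Definition unsquash z : R := ln (- ln z).

Lemma squashK : cancel squash unsquash.
Proof. by move=> u; rewrite /unsquash /squash expRK opprK expRK. Qed.

Lemma squash_itv u : 0 <= squash u <= 1.
Proof. by rewrite expR_ge0 -expR0 ler_expR oppr_le0 expR_ge0. Qed.

(** Interleaving the binary digits of two reals: a Borel injection of the plane
    into the line, with Borel left inverses.  It lets one real-valued variable do
    the work of several. *)
Definition encode u v : R :=
  value 3 (fun n => digit 2 (squash (if odd n then v else u)) n./2).

Definition decode1 z : R := unsquash (value 2 (fun n => digit 3 z n.*2)).

Definition decode2 z : R := unsquash (value 2 (fun n => digit 3 z n.*2.+1)).

Lemma encodeK1 u v : decode1 (encode u v) = u.
Proof.
rewrite /decode1 /encode digit_value -[RHS]squashK; congr unsquash.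
transitivity (value (2 : R) (digit 2 (squash u))); last first.
  exact: value_digit (squash_itv u).
congr value; apply/funext => n.
by rewrite odd_double doubleK.
Qed.

Lemma encodeK2 u v : decode2 (encode u v) = v.
Proof.
rewrite /decode2 /encode digit_value -[RHS]squashK; congr unsquash.
transitivity (value (2 : R) (digit 2 (squash v))); last first.
  exact: value_digit (squash_itv v).
congr value; apply/funext => n.
by rewrite /= odd_double uphalf_double.
Qed.

Let measurable_squash : measurable_fun setT squash.
Proof.
apply: measurableT_comp; first exact: measurable_expR.
by apply: measurableT_comp; [exact: oppr_measurable|exact: measurable_expR].
Qed.

Let measurable_unsquash : measurable_fun setT unsquash.
Proof.
apply: measurableT_comp; first exact: measurable_ln.
by apply: measurableT_comp; [exact: oppr_measurable|exact: measurable_ln].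
Qed.

Lemma measurable_encode : measurable_fun setT (fun p : R * R => encode p.1 p.2).
Proof.
apply: measurable_value => [|n]; first by rewrite ltr1n.
apply: (measurableT_comp (measurable_digit 2 n./2)).
apply: (measurableT_comp measurable_squash).
by case: (odd n); [exact: measurable_snd|exact: measurable_fst].
Qed.

Lemma measurable_decode1 : measurable_fun setT decode1.
Proof.
apply: (measurableT_comp measurable_unsquash).
by apply: measurable_value => [|n]; [rewrite ltr1n|exact: measurable_digit].
Qed.

Lemma measurable_decode2 : measurable_fun setT decode2.
Proof.
apply: (measurableT_comp measurable_unsquash).
by apply: measurable_value => [|n]; [rewrite ltr1n|exact: measurable_digit].
Qed.

(** The law of the code of two independent variables.  The first property computes
    with it, the second one yields its state space. *)
Lemma pair_law mu nu : exists P,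
  (forall f : R -> \bar R, measurable_fun setT f -> (forall z, 0 <= f z)%E ->
    (\int[P]_z f z = \int[mu]_u \int[nu]_v f (encode u v))%E) /\
  (forall A B C, measurable A -> measurable B -> measurable C ->
    mu A = 1%E -> nu B = 1%E -> (forall u v, A u -> B v -> C (encode u v)) ->
    P C = 1%E).
Proof.
pose m : {measure set (R * R) -> \bar R} := (mu \x nu)%E.
have m1 : m setT = 1%E.
  rewrite -setXTT; apply: etrans (product_measure1E mu nu measurableT measurableT) _.
  exact: etrans (congr2 mule (probability_setT mu) (probability_setT nu)) (mule1 _).
pose M : probability (R * R)%type R := unit_mass m1.
pose e : {mfun (R * R)%type >-> R} := HB.pack (fun p : R * R => encode p.1 p.2)
  (isMeasurableFun.Build _ _ _ _ _ measurable_encode).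
exists (distribution M e); split=> [f mf f0|A B C mA mB mC A1 B1 ABC]; last first.
  apply: le_anti; rewrite probability_le1//=.
  have <- : M (A `*` B) = 1%E.
    exact: etrans (product_measure1E mu nu mA mB)
      (etrans (congr2 mule A1 B1) (mule1 _)).
  apply: le_measure; rewrite ?inE; first exact: measurableX.
    by rewrite -[X in measurable X]setTI; exact: measurable_encode.
  by move=> [u v] /= []; exact: ABC.
rewrite ge0_integral_distribution//.
rewrite -(fubini_tonelli1 (fun p => f (encode p.1 p.2)))//.
exact: (measurableT_comp mf measurable_encode).
Qed.

(** A biased coin made from a countable source: with [z] geometric, that is equal
    to [n] with probability [2^-(n+1)], the [z]-th binary digit of [w] is 1 with
    probability [w].  A uniform [z] would not do for discrete state spaces. *)
Definition coin z w : bool := `[< exists2 n, z = n%:R & digit 2 w n >].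

Lemma measurable_coin : measurable_fun setT (fun p : R * R => coin p.1 p.2).
Proof.
apply: (measurable_fun_bool true) => //; rewrite setTI.
rewrite (_ : _ @^-1` _ = \bigcup_n
    ((fst @^-1` [set n%:R]) `&` (((digit 2 ^~ n) \o snd) @^-1` [set true]))).
  apply: bigcup_measurable => n _; apply: measurableI.
    by rewrite -[X in measurable X]setTI; exact: measurable_fst.
  rewrite -[X in measurable X]setTI.
  by apply: (measurableT_comp (measurable_digit 2 n)) => //; exact: measurable_snd.
apply/seteqP; split => -[z w] /=.
  by move=> /asboolP[n zn wn]; exists n.
by move=> [n _ [/= zn wn]]; apply/asboolP; exists n.
Qed.

Lemma coin_law : exists P, P (range (fun n => n%:R)) = 1%E /\
  forall w, 0 <= w <= 1 -> P [set z | coin z w] = w%:E.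
Proof.
have two1 : 1 < 2 :> R by rewrite ltr1n.
have c0 n : 0 <= (2 - 1) * 2^-1 ^+ n.+1 :> R.
  by rewrite mulr_ge0 ?exprn_ge0 ?invr_ge0 ?subr_ge0// ltW.
pose m : {measure set R -> \bar R} :=
  mseries (fun n => mscale (NngNum (c0 n)) (dirac (n%:R : R))) 0.
have mE A : m A = (\sum_(0 <= n <oo) ((2 - 1) * 2^-1 ^+ n.+1 * (n%:R \in A)%:R)%:E)%E.
  by apply: eq_eseriesr => n _.
have mT A : (forall n, A n%:R) -> m A = 1%E.
  move=> An; rewrite mE -(geometric_total two1); apply: eq_eseriesr => n _.
  by rewrite mem_set// mulr1.
exists (unit_mass (mT setT (fun=> I))).
split=> [|w w01]; first by apply: mT => n; exists n.
rewrite -[in RHS](value_digit w01) (valueE two1); apply: etrans (mE _) _.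
apply: eq_eseriesr => n _; congr (_ * _%:R)%:E; congr nat_of_bool.
apply/idP/idP; rewrite inE.
  by move=> /asboolP[p /eqP]; rewrite eqr_nat => /eqP <-.
by move=> wn; apply/asboolP; exists n.
Qed.

End Encoding.

Section StateSpaces.
Variable R : realType.

(** A probability has countably many atoms, and the line is uncountable. *)
Lemma null_value (P : probability R R) : exists c, P [set c] = 0%E.
Proof.
apply: contrapT => /forallNP h.
pose X : {mfun R >-> R} := HB.pack (idfun : R -> R)
  (isMeasurableFun.Build _ _ R R idfun (@measurable_id _ _ setT)).
have := @pmf_gt0_countable _ R R P X.
rewrite (_ : [set r | _] = setT); last first.
  apply/seteqP; split => // r _ /=; rewrite /pmf preimage_id.
  have Pr1 : (P [set r] < +oo)%E.
    by apply: le_lt_trans (ltry 1); apply: probability_le1.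
  by rewrite fine_gt0// Pr1 andbT lt0e measure_ge0 andbT; exact/eqP/h.
move=> /countable_lebesgue_measure0.
by rewrite -set_itvNyy lebesgue_measure_itv/=.
Qed.

Lemma state_space_setU1 kind (Omega : set R) c :
  state_space kind Omega -> state_space kind (Omega `|` [set c]).
Proof.
case: kind => /= h.
  have -> : Omega `|` [set c] = \bigcup_n bigcup2 Omega [set c] n.
    by rewrite bigcup2E.
  apply: bigcup_countable => [|n _]; first exact: countableP.
  by case: n => [|[|n]] /=; [exact: h|exact: countable1|exact: countable0].
exact: measurableU.
Qed.

Lemma measurable_state_space kind (Omega : set R) :
  state_space kind Omega -> measurable Omega.
Proof. by case: kind => //=; exact: countable_measurable. Qed.

(** For standard Borel spaces the whole line is large enough to hold the codes, so
    that the measurability of the image of [encode] is not an issue. *)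
Lemma state_space_encode kind (A B : set R) :
  state_space kind A -> state_space kind B ->
  exists2 C, state_space kind C & forall u v, A u -> B v -> C (encode u v).
Proof.
case: kind => /= hA hB; last by exists setT.
exists ((fun p => encode p.1 p.2) @` (A `*` B)) => [|u v Au Bv].
  by apply: sub_countable (card_image_le _ _) _; exact: countableX.
by exists (u, v).
Qed.

Lemma state_space_finite kind (A : set R) : finite_set A -> state_space kind A.
Proof.
move=> fA; case: kind => /=; first exact: finite_set_countable.
by apply: countable_measurable => //; exact: finite_set_countable.
Qed.

Lemma state_space_range kind : state_space kind (range (fun n => n%:R) : set R).
Proof.
have cN : countable (range (fun n => n%:R) : set R).
  by apply: sub_countable (card_image_le _ _) _.
by case: kind => //=; exact: countable_measurable.
Qed.

End StateSpaces.

(** * Configurations and kernels *)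

Section Configurations.
Context (R : realType) (I : finType).

Lemma measurable_coord (i : I) : measurable_fun setT (fun x : config R I => x i).
Proof.
move=> _ B mB; rewrite setTI; apply: sub_sigma_algebra.
by exists i, B; split.
Qed.

Lemma measurable_config d (T : measurableType d) (f : T -> config R I) :
  (forall i, measurable_fun setT (fun t => f t i)) -> measurable_fun setT f.
Proof.
move=> mf; apply: (@measurability _ _ T (config R I) setT f (@cylinders R I) erefl).
move=> _ [_ [i [B [mB ->]]] <-].
by have := mf i measurableT B mB.
Qed.

Lemma measurable_update (i : I) d (T : measurableType d) (f : T -> config R I)
    (g : T -> R) :
  measurable_fun setT f -> measurable_fun setT g ->
  measurable_fun setT (fun t => [eta f t with i |-> g t] : config R I).
Proof.
move=> mf mg; apply: measurable_config => j /=.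
by case: (eqVneq j i) => _ //; exact: measurableT_comp (measurable_coord j) mf.
Qed.

End Configurations.

Section Transport.
Context d1 d2 d3 d4 (X : measurableType d1) (X' : measurableType d2)
  (Y : measurableType d3) (Z : measurableType d4) (R : realType).
Variables (k : R.-pker X' ~> Y) (f : X -> X') (h : X * Y -> Z).

Section Reindex.
Hypothesis mf : measurable_fun setT f.

Definition reindex_kernel of measurable_fun setT f :
  X -> {measure set Y -> \bar R} := k \o f.

Let measurable_reindex U :
  measurable U -> measurable_fun setT (reindex_kernel mf ^~ U).
Proof. by move=> mU; exact: (measurableT_comp (measurable_kernel k U mU)). Qed.

HB.instance Definition _ :=
  isKernel.Build _ _ _ _ _ (reindex_kernel mf) measurable_reindex.

Let reindex1 x : reindex_kernel mf x setT = 1%E. Proof. exact: prob_kernel. Qed.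

HB.instance Definition _ :=
  Kernel_isProbability.Build _ _ _ _ _ (reindex_kernel mf) reindex1.

End Reindex.

Hypotheses (mf : measurable_fun setT f) (mh : measurable_fun setT h).

Import KCOMP_FINITE_KERNEL.

(** The general way of deriving a kernel from another one: read the configuration
    through [f], sample, then post-process the sample by [h]. *)
Definition transport : X -> {measure set Z -> \bar R} :=
  mkcomp (reindex_kernel mf) (kdirac mh).

HB.instance Definition _ := Kernel.on transport.

Lemma transportE x U : measurable U ->
  transport x U = k (f x) [set y | U (h (x, y))].
Proof.
move=> mU; rewrite /transport /mkcomp /= /kcomp /=.
rewrite (_ : (fun y => _) = EFin \o \1_[set y | U (h (x, y))]); last first.
  by apply/funext => y; rewrite /kdirac/= diracE /= indicE.
rewrite integral_indic ?setIT// -[X in measurable X]setTI.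
exact: (measurableT_comp mh (pair1_measurable x)).
Qed.

Let transport1 x : transport x setT = 1%E.
Proof. by rewrite transportE// -[RHS](prob_kernel (s := k) (f x)). Qed.

HB.instance Definition _ :=
  Kernel_isProbability.Build _ _ _ _ _ transport transport1.

End Transport.

(** * Iterated integrals *)

(** A kernel only provides measures; Tonelli needs sigma-finite ones. *)
Definition kernel_law d d' (X : measurableType d) (Y : measurableType d')
    (R : realType) (k : R.-pker X ~> Y) (x : X) : probability Y R :=
  unit_mass (prob_kernel (s := k) x).

Section Update.
Variables (R : realType) (I : eqType).
Implicit Types (x : I -> R) (i j : I).

Lemma update_comm x i j y z : i != j ->
  [eta [eta x with i |-> y] with j |-> z] = [eta [eta x with j |-> z] with i |-> y] :> (I -> R).
Proof.
move=> ij; apply/funext => t /=.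
by case: (eqVneq t j) => // ->; rewrite eq_sym (negbTE ij).
Qed.

Lemma update_same x i : [eta x with i |-> x i] = x :> (I -> R).
Proof. by apply/funext => t /=; case: eqVneq => // ->. Qed.

End Update.

Section IteratedIntegral.
Variables (R : realType) (V : finType) (D : lsgraph V).
Local Notation W := (vertex D).
Implicit Types (k : W -> R.-pker (config R W) ~> R) (s q r : seq W).
Implicit Types (F : config R W -> \bar R) (x : config R W) (u v w : W).

Lemma iterated_ge0 k s F x :
  (forall x, 0 <= F x)%E -> (0 <= iterated_integral k s F x)%E.
Proof.
by move=> F0; elim: s x => //= w s IH x; apply: integral_ge0 => y _; exact: IH.
Qed.

Lemma measurable_iterated k s F :
  (forall x, 0 <= F x)%E -> measurable_fun setT F ->
  measurable_fun setT (iterated_integral k s F).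
Proof.
move=> F0 mF; elim: s => //= w s IH.
apply: (measurable_fun_integral_finite_kernel (fun p : config R W * R =>
  iterated_integral k s F [eta p.1 with w |-> p.2])).
  by move=> p; exact: iterated_ge0.
exact: measurableT_comp IH (measurable_update w measurable_fst measurable_snd).
Qed.

Lemma iterated_cat k s r F :
  iterated_integral k (s ++ r) F = iterated_integral k s (iterated_integral k r F).
Proof.
elim: s => //= w s IH; apply/funext => x.
by apply: eq_integral => y _; rewrite IH.
Qed.

(** It suffices to compare the kernels on an invariant that no sampling step of [s]
    can break, such as the value of a coordinate outside [s]. *)
Lemma eq_iterated_in (I : config R W -> Prop) k k' s F F' x :
  (forall w, w \in s -> forall x y, I x -> I [eta x with w |-> y]) ->
  (forall w, w \in s -> forall x B, I x -> measurable B -> k w x B = k' w x B) ->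
  (forall x, I x -> F x = F' x) -> I x ->
  iterated_integral k s F x = iterated_integral k' s F' x.
Proof.
move=> Iup kk' FF'; elim: s x Iup kk' => [|w s IH] x Iup kk' Ix /=; first exact: FF'.
have ws : w \in w :: s by rewrite inE eqxx.
rewrite (eq_measure_integral (k' w x)) => [|B mB _]; last exact: kk'.
apply: eq_integral => y _; apply: IH => [v vs|v vs|]; last exact: Iup.
- by apply: Iup; rewrite inE vs orbT.
- by apply: kk'; rewrite inE vs orbT.
Qed.

Lemma eq_iterated k k' s F F' x :
  (forall w, w \in s -> forall x B, measurable B -> k w x B = k' w x B) ->
  F =1 F' -> iterated_integral k s F x = iterated_integral k' s F' x.
Proof.
by move=> kk' FF'; apply: (@eq_iterated_in (fun=> True)) => // w ws y B _; exact: kk'.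
Qed.

Lemma iterated_suffix k s q r F x :
  (forall x, iterated_integral k q F x = iterated_integral k r F x) ->
  iterated_integral k (s ++ q) F x = iterated_integral k (s ++ r) F x.
Proof. by move=> qr; rewrite !iterated_cat; exact: eq_iterated. Qed.

Lemma iterated_cst k s (c : \bar R) x : iterated_integral k s (fun=> c) x = c.
Proof.
elim: s x => //= w s IH x; under eq_integral do rewrite IH.
by rewrite integral_cst /= ?prob_kernel ?mule1.
Qed.

Lemma iterated_series k s (F : nat -> config R W -> \bar R) x :
  (forall n x, 0 <= F n x)%E -> (forall n, measurable_fun setT (F n)) ->
  iterated_integral k s (fun x => \sum_(0 <= n <oo) F n x)%E x =
  (\sum_(0 <= n <oo) iterated_integral k s (F n) x)%E.
Proof.
move=> F0 mF; elim: s x => //= w s IH x.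
under eq_integral do rewrite IH.
rewrite integral_nneseries// => n; last by move=> y _; exact: iterated_ge0.
apply: (measurableT_comp (measurable_iterated k s (F0 n) (mF n))).
by apply: measurable_update => //; exact: measurable_cst.
Qed.

Lemma measurable_iterated_update k s F w x :
  (forall x, 0 <= F x)%E -> measurable_fun setT F ->
  measurable_fun setT (fun y => iterated_integral k s F [eta x with w |-> y]).
Proof.
move=> F0 mF; apply: (measurableT_comp (measurable_iterated k s F0 mF)).
by apply: measurable_update => //; exact: measurable_cst.
Qed.

Lemma iterated_dirac k w s F x y :
  (forall x, 0 <= F x)%E -> measurable_fun setT F ->
  (forall B, measurable B -> k w x B = \d_y B) ->
  iterated_integral k (w :: s) F x = iterated_integral k s F [eta x with w |-> y].
Proof.
move=> F0 mF kw /=; rewrite (eq_measure_integral \d_y) => [|B mB _]; last exact: kw.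
by rewrite integral_dirac ?diracT ?mul1e//; exact: measurable_iterated_update.
Qed.

Definition ignores (kw : R.-pker (config R W) ~> R) u : Prop :=
  forall x y B, measurable B -> kw [eta x with u |-> y] B = kw x B.

(** Tonelli for two vertices that do not look at each other. *)
Lemma iterated_swap k u v s F x :
  (forall x, 0 <= F x)%E -> measurable_fun setT F ->
  u != v -> ignores (k u) v -> ignores (k v) u ->
  iterated_integral k (u :: v :: s) F x = iterated_integral k (v :: u :: s) F x.
Proof.
move=> F0 mF uv ku kv /=.
have mG : measurable_fun setT (iterated_integral k s F) by exact: measurable_iterated.
pose G (p : R * R) :=
  iterated_integral k s F [eta [eta x with u |-> p.1] with v |-> p.2].
transitivity (\int[k u x]_y \int[k v x]_z G (y, z))%E.
  apply: eq_integral => y _; apply: eq_measure_integral => B mB _; exact: kv.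
have mG' : measurable_fun setT G.
  apply: (measurableT_comp mG); apply: measurable_update; last exact: measurable_snd.
  by apply: measurable_update; [exact: measurable_cst|exact: measurable_fst].
have G0 p : (0 <= G p)%E by exact: iterated_ge0.
apply: etrans (fubini_tonelli (m1 := kernel_law (k u) x)
  (m2 := kernel_law (k v) x) G mG' G0) _.
apply: eq_integral => z _.
transitivity (\int[k u x]_y
    iterated_integral k s F [eta [eta x with v |-> z] with u |-> y])%E.
  by apply: eq_integral => y _; rewrite /G update_comm.
by apply: eq_measure_integral => B mB _; apply/esym/ku.
Qed.

Lemma iterated_move k u q r F x :
  (forall x, 0 <= F x)%E -> measurable_fun setT F ->
  (forall v, v \in q -> [/\ u != v, ignores (k u) v & ignores (k v) u]) ->
  iterated_integral k (q ++ u :: r) F x = iterated_integral k (u :: q ++ r) F x.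
Proof.
move=> F0 mF; elim: q x => [|v q IH] x uq //.
have [uv ku kv] : [/\ u != v, ignores (k u) v & ignores (k v) u].
  by apply: uq; rewrite inE eqxx.
rewrite [RHS](iterated_swap (v := v))//=; apply: eq_integral => y _.
by apply: IH => w wq; apply: uq; rewrite inE wq orbT.
Qed.

Lemma iterated_ignores k u s F x y :
  u \notin s -> (forall w, w \in s -> ignores (k w) u) ->
  (forall x y, F [eta x with u |-> y] = F x) ->
  iterated_integral k s F [eta x with u |-> y] = iterated_integral k s F x.
Proof.
move=> us ku Fu; elim: s x us ku => //= w s IH x; rewrite inE negb_or => /andP[uw us] ku.
rewrite (eq_measure_integral (k w x)) => [|B mB _]; last first.
  by apply: ku => //; rewrite inE eqxx.
apply: eq_integral => z _; rewrite update_comm// IH// => v vs.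
by apply: ku; rewrite inE vs orbT.
Qed.

End IteratedIntegral.

(** Two systems of kernels that correspond step by step through a recoding [g] of
    configurations have corresponding iterated integrals.  All comparisons between
    different graphs go through this lemma. *)
Lemma iterated_recode (R : realType) (V V' : finType) (D : lsgraph V)
    (D' : lsgraph V') (k : vertex D -> R.-pker (config R (vertex D)) ~> R)
    (k' : vertex D' -> R.-pker (config R (vertex D')) ~> R)
    (iota : vertex D -> vertex D')
    (g : config R (vertex D) -> config R (vertex D'))
    (h : vertex D -> R -> R) (s : seq (vertex D))
    (F : config R (vertex D') -> \bar R) (x : config R (vertex D)) :
  (forall x, 0 <= F x)%E -> measurable_fun setT F ->
  (forall w, w \in s -> measurable_fun setT (h w)) ->
  (forall w, w \in s -> forall x y,
    g [eta x with w |-> y] = [eta g x with iota w |-> h w y]) ->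
  (forall w, w \in s -> forall x B, measurable B ->
    k' (iota w) (g x) B = k w x (h w @^-1` B)) ->
  iterated_integral k s (F \o g) x = iterated_integral k' (map iota s) F (g x).
Proof.
move=> F0 mF; elim: s x => //= w s IH x mh gh kh.
have ws : w \in w :: s by rewrite inE eqxx.
have mhw := mh w ws.
transitivity (\int[pushforward (k w x) (h w)]_y
    iterated_integral k' (map iota s) F [eta g x with iota w |-> y])%E.
  rewrite [RHS](ge0_integral_pushforward mhw)//; last 2 first.
  - apply: (measurableT_comp (measurable_iterated k' (map iota s) F0 mF)).
    by apply: measurable_update => //; exact: measurable_cst.
  - by move=> y _; exact: iterated_ge0.
  apply: eq_integral => y _ /=; rewrite -gh// IH// => v vs.
  - by apply: mh; rewrite inE vs orbT.
  - by apply: gh; rewrite inE vs orbT.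
  - by apply: kh; rewrite inE vs orbT.
apply: eq_measure_integral => B mB _; by rewrite kh.
Qed.

Section FiniteFibers.
Context d (T : measurableType d) (R : realType) (J : finType) (p : T -> J).
Hypothesis mp : forall j, measurable (p @^-1` [set j]).

Lemma measurable_fun_fibers d' (T' : measurableType d') (g : J -> T') :
  measurable_fun setT (g \o p).
Proof.
move=> _ B mB; rewrite setTI.
rewrite (_ : _ @^-1` B = \bigcup_(j in [set j | B (g j)]) p @^-1` [set j]).
  by apply: fin_bigcup_measurable => //; exact: finite_finset.
by apply/seteqP; split => [t Bt|t [j Bj /= ->]//]; exists (p t).
Qed.

Lemma integral_fibers (mu : {measure set T -> \bar R}) (A : set T)
    (f : T -> \bar R) :
  measurable A -> measurable_fun A f -> (forall t, 0 <= f t)%E ->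
  (\int[mu]_(t in A) f t = \sum_j \int[mu]_(t in A `&` p @^-1` [set j]) f t)%E.
Proof.
move=> mA mf f0.
pose F j := A `&` p @^-1` [set j].
have AE : A = \big[setU/set0]_(j <- index_enum J) F j.
  rewrite -bigcup_seq; apply/seteqP; split => [t At|t [j _ []]//].
  by exists (p t) => //=; exact: mem_index_enum.
rewrite [in LHS]AE; apply: ge0_integral_bigsetU => //.
- by move=> j; exact: measurableI.
- exact: index_enum_uniq.
- by move=> i j _ _ [t [[_ /= <-] [_ /= <-]]].
- by rewrite -AE.
Qed.

End FiniteFibers.

Section IteratedLaw.
Variables (R : realType) (V : finType) (D : lsgraph V).
Variables (k : vertex D -> R.-pker (config R (vertex D)) ~> R).
Variables (s : seq (vertex D)) (x : config R (vertex D)).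

(** Countable additivity is monotone convergence at each level of the iterated
    integral. *)
Lemma iterated_law : exists P : probability (config R (vertex D)) R,
  forall A, measurable A -> P A = iterated_integral k s (fun y => (\1_A y)%:E) x.
Proof.
pose m (A : set (config R (vertex D))) : \bar R :=
  iterated_integral k s (fun y => (\1_A y)%:E) x.
have m0 : m set0 = 0%E.
  rewrite /m -[RHS](iterated_cst k s 0 x); apply: eq_iterated => // y.
  by rewrite indic0.
have m_ge0 A : (0 <= m A)%E by apply: iterated_ge0 => y; rewrite lee_fin.
have m_sigma : semi_sigma_additive m.
  move=> F mF tF mUF; apply/cvg_closeP; split.
    by apply: is_cvg_nneseries => n _ _; exact: m_ge0.
  rewrite closeE// /m -iterated_series.
  - apply: eq_iterated => // y.
    by rewrite -[RHS]/(\d_y (\bigcup_n F n)) measure_semi_bigcup.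
  - by move=> n y; rewrite lee_fin.
  - by move=> n; apply/measurable_EFinP; exact: measurable_indic.
pose M : {measure set (config R (vertex D)) -> \bar R} :=
  HB.pack m (isMeasure.Build _ _ _ m m0 m_ge0 m_sigma).
have M1 : M setT = 1%E.
  rewrite -[RHS](iterated_cst k s 1 x); apply: eq_iterated => // y.
  by rewrite indicT.
by exists (unit_mass M1).
Qed.

End IteratedLaw.

(** * Selected models without conditional probabilities *)

Section LawKernel.
Context d d' (X : measurableType d) (Y : measurableType d') (R : realType).
Variable P : X -> probability Y R.

Definition law_kernel
    of (forall U, measurable U -> measurable_fun setT (fun x => P x U)) :
  X -> {measure set Y -> \bar R} := P.

Hypothesis mP : forall U, measurable U -> measurable_fun setT (fun x => P x U).

HB.instance Definition _ := isKernel.Build _ _ _ _ _ (law_kernel mP) mP.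

Let law_kernel1 x : law_kernel mP x setT = 1%E. Proof. exact: probability_setT. Qed.

HB.instance Definition _ :=
  Kernel_isProbability.Build _ _ _ _ _ (law_kernel mP) law_kernel1.

End LawKernel.

Lemma measurable_forall d (T : measurableType d) (J : finType) (Q : J -> T -> Prop) :
  (forall j, measurable [set t | Q j t]) -> measurable [set t | forall j, Q j t].
Proof.
move=> mQ; rewrite (_ : [set t | _] = \bigcap_(j in setT) [set t | Q j t]).
  by apply: fin_bigcap_measurable => //; exact: finite_finset.
by apply/seteqP; split => [t Qt j _|t Qt j]; exact: Qt.
Qed.

Section SelectedModel.
Variables (R : realType) (V : finType) (D : lsgraph V).
Local Notation W := (vertex D).
Implicit Types (k : W -> R.-pker (config R W) ~> R) (s : seq W).
Implicit Types (A : set (config R V)) (x : config R W).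

Definition selection_event A : set (config R W) :=
  [set x | A (visible_part x) /\ forall t : svert D, x (Selected t) = 0].

Definition selected_mass k s A : \bar R :=
  iterated_integral k s (fun x => (\1_(selection_event A) x)%:E) (fun=> 0).

Lemma measurable_visible_part : measurable_fun setT (@visible_part R V D).
Proof. by apply: measurable_config => v; exact: measurable_coord. Qed.

Lemma measurable_selected_part : measurable_fun setT (@selected_part R V D).
Proof. by apply: measurable_config => v; exact: measurable_coord. Qed.

Lemma measurable_coord_set (I : finType) (i : I) (B : set R) : measurable B ->
  measurable [set x : config R I | B (x i)].
Proof. by move=> mB; rewrite -[X in measurable X]setTI; exact: measurable_coord. Qed.

Lemma measurable_selection_event A : measurable A -> measurable (selection_event A).
Proof.
move=> mA; apply: measurableI.
  by rewrite -[X in measurable X]setTI; exact: measurable_visible_part.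
apply: measurable_forall => t.
exact: (measurable_coord_set (Selected t : W) (measurable_set1 0)).
Qed.

Lemma measurable_coord_neq (v : V) (c : R) :
  measurable [set x : config R V | x v != c].
Proof.
rewrite (_ : [set x | _] = ~` [set x : config R V | x v = c]).
  exact: measurableC (measurable_coord_set v (measurable_set1 c)).
by apply/seteqP; split => x /= /eqP.
Qed.

(** The laws that are proportional to a [selected_mass].  No joint law and no
    regular conditional probability appear, which makes this form convenient for
    comparing two graphs. *)
Definition selected_model (kind : space_kind) : set (probability (config R V) R) :=
  [set Q | exists (Omega : W -> set R) (k : W -> R.-pker (config R W) ~> R)
             (s : seq W),
    [/\ (forall w, state_space kind (Omega w)) /\
          (forall w x, k w x (Omega w) = 1%E),
        (forall w, parental w (k w)) /\ topological_order s,
        forall v : V, deterministic (k (Visible v)),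
        (0 < selected_mass k s setT)%E &
        forall A, measurable A ->
          selected_mass k s A = (Q A * selected_mass k s setT)%E]].

(** On [X_S = 0] the conditional probability is the constant [K 0], so integrating
    it over this event gives the required proportionality. *)
Lemma smo_selected kind : @smo_model R V D kind `<=` selected_model kind.
Proof.
move=> Q [Om [k [P [K [state [par [s topo PE]] det P0 [regular QE]]]]]].
have massE A : measurable A -> selected_mass k s A = P (selection_event A).
  by move=> mA; rewrite PE//; exact: measurable_selection_event.
have m0 : measurable [set y : config R (svert D) | forall t, y t = 0].
  by apply: measurable_forall => i; exact: (measurable_coord_set i (measurable_set1 0)).
pose E := [set x : config R W | forall t : svert D, x (Selected t) = 0%R].
have selE A : measurable A -> P (selection_event A) = (Q A * P E)%E.
  move=> mA; have := regular A _ mA m0.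
  rewrite [X in P X = _](_ : _ = selection_event A)// => ->.
  rewrite [X in (\int[_]_(x in X) _)%E](_ : _ = E)// QE//.
  have mE : measurable E.
    by apply: measurable_forall => i;
      exact: (measurable_coord_set (Selected i : W) (measurable_set1 0)).
  rewrite -integral_cst//; apply: eq_integral => x; rewrite inE => Ex.
  by congr (K _ A); apply/funext => i; exact: Ex.
have TE : P (selection_event setT) = P E.
  by congr (P _); apply/seteqP; split => x /=; [case|split].
exists Om, k, s; split=> //.
- by rewrite massE// TE.
- by move=> A mA; rewrite !massE// TE selE.
Qed.

End SelectedModel.

(** The elementary conditional probability given [E].  The case [P E = 0] is
    covered because both sides then vanish. *)
Lemma mnormalize_restrE d (T : measurableType d) (R : realType)
    (P : probability T R) (E A : set T) (mE : measurable E) : measurable A ->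
  (mnormalize (mrestr P mE) P A * P E = P (A `&` E))%E.
Proof.
move=> mA; have PE : P E \is a fin_num by exact: fin_num_measure.
have mT : mrestr P mE setT = P E by rewrite /mrestr setTI.
rewrite /mnormalize /= mT; case: ifPn => [/orP[/eqP p0|/eqP poo]|].
- rewrite p0 mule0; apply/esym/eqP; rewrite -measure_le0 -p0.
  by apply: le_measure; rewrite ?inE//; exact: measurableI.
- by move: PE; rewrite poo.
- rewrite negb_or => /andP[p0 _].
  by rewrite -muleA -{2}(fineK PE) -EFinM mulVf ?fine_eq0// mule1.
Qed.

Section SelectedSmo.
Variables (R : realType) (V : finType) (D : lsgraph V).
Local Notation W := (vertex D).
Hypothesis sink : forall t w, arrow D (Selected t) w = false.

(** Selected vertices only matter through the event [X_S = 0]: they may be replaced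
    by bits telling whether they vanish. *)
Definition bit (w : W) (r : R) : R := if w is Selected _ then (r != 0)%:R else r.

Definition binarize (x : config R W) : config R W := fun w => bit w (x w).

Lemma measurable_bit w : measurable_fun setT (bit w).
Proof.
case: w => [[v|m]|t]; [exact: measurable_id|exact: measurable_id|].
rewrite (_ : bit _ = fun r : R => if r == 0 then 0 else 1); last first.
  by apply/funext => r /=; case: eqVneq.
by apply: measurable_fun_ifT => //; apply: measurable_fun_eqr.
Qed.

Lemma measurable_binarize : measurable_fun setT binarize.
Proof.
apply: measurable_config => w.
exact: measurableT_comp (measurable_bit w) (measurable_coord w).
Qed.

Definition zero_pattern (y : config R (svert D)) : {ffun svert D -> bool} :=
  [ffun t => y t == 0].

Lemma measurable_zero_pattern d (T : measurableType d) (f : T -> config R (svert D)) j :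
  measurable_fun setT f -> measurable ((zero_pattern \o f) @^-1` [set j]).
Proof.
move=> mf.
rewrite (_ : _ @^-1` _ = [set t | forall i, (f t i == 0) = j i]); last first.
  apply/seteqP; split => [t /= <- i|t /= h]; first by rewrite ffunE.
  by apply/ffunP => i; rewrite ffunE.
apply: measurable_forall => i.
have m0 : measurable_fun setT (fun t => f t i == 0).
  apply: measurable_fun_eqr => //.
  exact: measurableT_comp (measurable_coord i) mf.
by rewrite -[X in measurable X]setTI; exact: (m0 measurableT [set j i]).
Qed.

(** A model is owed a regular conditional probability given all of [X_S].
    Replacing each selected variable by the bit telling whether it is zero leaves
    the selected masses unchanged, because no kernel reads a selected vertex; after
    this [X_S] takes finitely many values, and the elementary conditional
    probabilities given these values form a regular one. *)
Lemma selected_smo kind : selected_model D kind `<=` @smo_model R V D kind.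
Proof.
move=> Q [Om [k [s [[Omk k1] [par topo] det mass0 massE]]]].
have [P0 P0E] := iterated_law k s (fun=> 0).
pose H : {mfun config R W >-> config R W} :=
  HB.pack binarize (isMeasurableFun.Build _ _ _ _ _ measurable_binarize).
pose vis : {mfun config R W >-> config R V} := HB.pack (@visible_part R V D)
  (isMeasurableFun.Build _ _ _ _ _ (@measurable_visible_part R V D)).
pose P : probability (config R W) R := distribution P0 H.
have mbit w : measurable_fun setT (fun p : config R W * R => bit w p.2).
  exact: measurableT_comp (measurable_bit w) measurable_snd.
pose kb w : R.-pker config R W ~> R :=
  transport (k w) (@measurable_id _ _ setT) (mbit w).
have kbE w x B : measurable B -> kb w x B = k w x (bit w @^-1` B).
  by move=> mB; rewrite /kb transportE.
pose pat (x : config R W) := zero_pattern (selected_part x).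
have mpat j : measurable (pat @^-1` [set j]).
  exact: measurable_zero_pattern (@measurable_selected_part R V D).
pose kappa j : probability (config R V) R :=
  distribution (mnormalize (mrestr P0 (mpat j)) P0) vis.
(* [kappa j] is the law of [X_V] given the zero pattern [j] of the selected part. *)
have kappaE j A : measurable A ->
    (kappa j A * P0 (pat @^-1` [set j]) = P0 (vis @^-1` A `&` pat @^-1` [set j]))%E.
  move=> mA.
  have mvA : measurable (vis @^-1` A).
    by rewrite -[X in measurable X]setTI; exact: measurable_funP.
  exact: mnormalize_restrE.
have mK U : measurable U ->
    measurable_fun setT (fun y => kappa (zero_pattern y) U).
  move=> mU; apply: (measurable_fun_fibers _ (fun j => kappa j U)) => j.
  exact: (measurable_zero_pattern j (@measurable_id _ _ setT)).
exists (fun w => if w is Selected _ then [set 0; 1] else Om w), kb, P, (law_kernel mK).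
split.
- split=> [[w|t]|w x]; [exact: Omk|by apply: state_space_finite; exact: finite_set2|].
  case: w => [w|t]; rewrite kbE.
  + by rewrite preimage_id.
  + exact: measurable_state_space (Omk _).
  + rewrite (_ : _ @^-1` _ = setT) ?prob_kernel//.
    by apply/seteqP; split => // r _ /=; case: (r != 0); [right|left].
  + by apply: measurableU; exact: measurable_set1.
- split=> [w x y xy B mB|].
    rewrite !kbE//; apply: par => //.
    by rewrite -[X in measurable X]setTI; exact: measurable_bit.
  exists s => // A mA.
  have mHA : measurable (H @^-1` A).
    by rewrite -[X in measurable X]setTI; exact: measurable_funP.
  rewrite [LHS]P0E//.
  have -> : (fun=> 0) = binarize (fun=> 0) :> config R W.
    by apply/funext => -[w|t] //=; rewrite /binarize /= eqxx.
  rewrite -[in RHS](map_id s).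
  rewrite -(iterated_recode (k := k) (iota := id) (g := binarize) (h := bit)).
  - by congr iterated_integral; apply/funext => -[w|t] //=; rewrite /binarize /= eqxx.
  - by move=> x; rewrite lee_fin.
  - by apply/measurable_EFinP; exact: measurable_indic.
  - by move=> w _; exact: measurable_bit.
  - move=> w _ x y; apply/funext => v /=; rewrite /binarize /=.
    by case: eqVneq => // ->.
  - move=> w _ x B mB; rewrite kbE//; apply: par => [u uw|].
      by case: u uw => // t; rewrite sink.
    by rewrite -[X in measurable X]setTI; exact: measurable_bit.
- move=> v; have [f fE] := det v; exists f => x B mB.
  by rewrite kbE// preimage_id fE.
- have mE : measurable (selection_event (D := D) (@setT (config R V))).
    exact: measurable_selection_event.
  rewrite [X in (_ < X)%E](_ : _ = selected_mass k s setT)//.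
  rewrite /selected_mass -P0E//; congr (P0 _); apply/seteqP; split => x /=.
    move=> h; split=> // t; apply/eqP; have := h t; rewrite /binarize /=.
    by case: eqVneq => // _ /eqP; rewrite oner_eq0.
  by move=> [_ h] t; rewrite /binarize /= h eqxx.
split.
- move=> A B mA mB.
  have mC : measurable (vis @^-1` A).
    by rewrite -[X in measurable X]setTI; exact: measurable_funP.
  have mselB : measurable (@selected_part R V D @^-1` B).
    by rewrite -[X in measurable X]setTI; exact: measurable_selected_part.
  pose E := H @^-1` (@selected_part R V D @^-1` B).
  have mE : measurable E.
    by rewrite -[X in measurable X]setTI; exact: measurable_funP.
  have patH x : zero_pattern (selected_part (binarize x)) = pat x.
    apply/ffunP => t; rewrite !ffunE /selected_part /binarize /=.
    by rewrite pnatr_eq0 eqb0 negbK.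
  have mkap : measurable_fun setT (fun x => kappa (zero_pattern (selected_part x)) A).
    by apply: (measurable_fun_fibers mpat (fun j => kappa j A)).
  transitivity (\int[P0]_(x in E) kappa (pat x) A)%E; last first.
    apply/esym; apply: etrans (ge0_integral_pushforward measurable_binarize P0 mselB _ _) _.
    - exact: measurable_funTS.
    - by move=> x _; exact: measure_ge0.
    - by apply: eq_integral => x _ /=; rewrite patH.
  transitivity (\int[P0]_(x in vis @^-1` A `&` E) 1)%E.
    by rewrite integral_cst ?mul1e//; exact: measurableI.
  rewrite (integral_fibers mpat)//; last exact: measurableI.
  rewrite (integral_fibers mpat)//; last exact: measurable_funTS.
  apply: eq_bigr => j _; rewrite integral_cst ?mul1e; last first.
    by apply: measurableI => //; exact: measurableI.
  rewrite (eq_integral (fun=> kappa j A)); last by move=> x; rewrite inE => -[_ /= ->].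
  rewrite integral_cst; last exact: measurableI.
  (* The binarized selected part is a function of the zero pattern. *)
  have Ej x : pat x = j -> E x = B (fun t => (~~ j t)%:R).
    move=> <-; rewrite /E /preimage/=; congr B; apply/funext => t.
    by rewrite ffunE.
  have [Bj|nBj] := pselect (B (fun t => (~~ j t)%:R)).
    have -> : E `&` pat @^-1` [set j] = pat @^-1` [set j].
      by apply/seteqP; split => [x []//|x /= xj]; split=> //; rewrite Ej.
    rewrite kappaE//; congr (P0 _); apply/seteqP; split => [x [[? _] ?]//|x [? /= xj]].
    by split=> //; split=> //; rewrite Ej.
  have -> : E `&` pat @^-1` [set j] = set0.
    by apply/seteqP; split => // x [Ex /= xj]; apply: nBj; rewrite -(Ej x).
  rewrite measure0 mule0 -setIA (_ : E `&` _ = set0) ?setI0 ?measure0//.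
  by apply/seteqP; split => // x [Ex /= xj]; apply: nBj; rewrite -(Ej x).
- move=> A mA /=; rewrite /law_kernel.
  pose j0 : {ffun svert D -> bool} := zero_pattern (fun=> 0).
  have selE A' : measurable A' ->
      P0 (vis @^-1` A' `&` pat @^-1` [set j0]) = selected_mass k s A'.
    move=> mA'; rewrite /selected_mass -P0E; last exact: measurable_selection_event.
    congr (P0 _); apply/seteqP; split => x [vA /= h]; split=> //=.
      by move=> t; apply/eqP; move/ffunP : h => /(_ t); rewrite !ffunE eqxx.
    by apply/ffunP => t; rewrite !ffunE [X in X == _]h.
  have P0j : P0 (pat @^-1` [set j0]) = selected_mass k s setT.
    by rewrite -selE// preimage_setT setTI.
  have fin : selected_mass k s setT \is a fin_num.
    by rewrite -P0j; exact: fin_num_measure.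
  have := kappaE j0 A mA; rewrite selE// massE// P0j => e.
  have le_e u v : (u * selected_mass k s setT = v * selected_mass k s setT -> u <= v)%E.
    by move=> uv; rewrite -(lee_pmul2r fin mass0) uv.
  by apply: le_anti; rewrite !le_e.
Qed.

End SelectedSmo.

Lemma smo_modelE (R : realType) (V : finType) (D : lsgraph V) kind :
  (forall t w, arrow D (Selected t) w = false) ->
  @smo_model R V D kind = @selected_model R V D kind.
Proof.
by move=> sink; apply/seteqP; split; [exact: smo_selected|exact: selected_smo].
Qed.

(** * Topological orders *)

Section Order.
Variables (R : realType) (V : finType) (D : lsgraph V).
Local Notation W := (vertex D).

(** For a loop-free graph on a duplicate-free enumeration this is the order
    condition of [topological_order] in a form that is stable under subsequences and
    concatenation. *)
Definition ordered (s : seq W) : bool := pairwise (fun u w => ~~ arrow D w u) s.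

Lemma topological_orderP (s : seq W) :
  topological_order s <->
  [/\ uniq s, s =i W, irreflexive (arrow D) & ordered s].
Proof.
split=> [[us sW lt_index]|[us sW irr os]].
  split=> // [u|].
    by apply/negP => /lt_index; rewrite ltnn.
  case: s us sW lt_index => // w0 s us sW lt_index.
  apply/(pairwiseP w0) => i j; rewrite !inE => si sj ij.
  apply/negP => /lt_index; rewrite !index_uniq//.
  by rewrite ltnNge (ltnW ij).
split=> // u w uw; have us' : u \in s by rewrite sW.
have ws' : w \in s by rewrite sW.
rewrite ltnNge leq_eqVlt; apply/negP => /orP[/eqP e|lt_wu].
  have wu : w = u by rewrite -(nth_index u ws') e nth_index.
  by move: uw; rewrite wu irr.
have /(pairwiseP u)/(_ _ _ _ _ lt_wu) := os.
by rewrite !inE !index_mem us' ws' !nth_index// uw => /(_ isT isT).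
Qed.

Variable k : W -> R.-pker (config R W) ~> R.
Hypothesis par : forall w, parental w (k w).

Lemma parental_ignores u w : ~~ arrow D u w -> ignores (k w) u.
Proof.
move=> uw x y B mB; apply: par => // v vw /=.
by case: eqVneq vw => // ->; rewrite (negbTE uw).
Qed.

Lemma iterated_source u s :
  uniq s -> ordered s -> u \in s -> (forall v, arrow D v u = false) ->
  exists r, [/\ perm_eq s (u :: r), subseq r s &
    forall F x, (forall x, 0 <= F x)%E -> measurable_fun setT F ->
      iterated_integral k s F x = iterated_integral k (u :: r) F x].
Proof.
move=> us os u_s usrc; case/splitPr: u_s us os => q r us os.
exists (q ++ r); split.
- exact: permEl (perm_catCA q [:: u] r).
- exact: cat_subseq (subseq_refl q) (subseq_cons r u).
move=> F x F0 mF; apply: iterated_move => // v vq; split.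
- move: us; rewrite cat_uniq => /and3P[_ /hasPn/(_ u (mem_head _ _)) uq _].
  by apply: contraNneq uq => ->.
- by apply: parental_ignores; rewrite usrc.
- apply: parental_ignores; move: os; rewrite /ordered pairwise_cat => /andP[+ _].
  by move=> /allrelP/(_ v u vq); apply; rewrite inE eqxx.
Qed.

End Order.

Lemma measurable_deterministic (R : realType) (I : finType)
    (k : R.-pker (config R I) ~> R) (f : config R I -> R) :
  (forall x B, measurable B -> k x B = \d_(f x) B) -> measurable_fun setT f.
Proof.
move=> kf _ B mB; rewrite setTI.
have := measurable_kernel k B mB measurableT [set 1%E] (emeasurable_set1 _).
rewrite setTI; congr measurable; apply/seteqP; split => x /=; rewrite kf// diracE.
  by case: (boolP (f x \in B)) => [|_ /eqP]; rewrite ?inE// eqe eq_sym oner_eq0.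
by move=> Bf; rewrite mem_set.
Qed.

Lemma deterministic_inj (R : realType) (I : finType)
    (k : R.-pker (config R I) ~> R) (f : config R I -> R) x y :
  (forall x B, measurable B -> k x B = \d_(f x) B) ->
  (forall B, measurable B -> k x B = k y B) -> f x = f y.
Proof.
move=> kf /(_ [set f y] (measurable_set1 _)); rewrite !kf; try exact: measurable_set1.
rewrite !diracE [in RHS]mem_set//.
by case: (boolP (f x \in _)) => [|_ /eqP]; rewrite ?inE// eqe eq_sym oner_eq0.
Qed.

(** * Absorbing a marginalized-selected pair into another one *)

Section Embedding.
Variables (V : finType) (D D' : lsgraph V).
Variables (em : mvert D' -> mvert D) (es : svert D' -> svert D).

Definition embed (w : vertex D') : vertex D :=
  match w with
  | Visible v => Visible v
  | Marginalized m => Marginalized (em m)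
  | Selected t => Selected (es t)
  end.

End Embedding.

(** The combinatorial situation: besides the vertices of [D'], the graph [D] has a
    source [extra_m], whose children are [extra_s] and children of the marginalized
    vertex [host_m] of [D'], and a sink [extra_s], whose parents are [extra_m] and
    [a].  Since [a] is a child of [host_m] and a parent of the selected vertex
    [host_s], the vertex [host_m] can take over the role of [extra_m] and, through
    [a], the vertex [host_s] that of [extra_s]. *)
Record absorption (V : finType) (D D' : lsgraph V) (a : V) := Absorption {
  emb_m : mvert D' -> mvert D;
  emb_s : svert D' -> svert D;
  extra_m : mvert D;
  extra_s : svert D;
  host_m : mvert D';
  host_s : svert D';
  emb_m_inj : injective emb_m;
  emb_s_inj : injective emb_s;
  extra_m_new : forall m, emb_m m != extra_m;
  extra_s_new : forall t, emb_s t != extra_s;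
  emb_m_cover : forall m, m != extra_m -> exists m', m = emb_m m';
  emb_s_cover : forall t, t != extra_s -> exists t', t = emb_s t';
  emb_arrow : forall u w,
    arrow D (embed emb_m emb_s u) (embed emb_m emb_s w) = arrow D' u w;
  sink_s : forall t w, arrow D (Selected t) w = false;
  source_m : forall u m, arrow D u (Marginalized m) = false;
  extra_s_parents : forall u, arrow D u (Selected extra_s) =
    (u == Visible a) || (u == Marginalized extra_m);
  extra_m_children : forall w,
    arrow D (Marginalized extra_m) (embed emb_m emb_s w) ->
    arrow D' (Marginalized host_m) w;
  host_m_arrow : arrow D' (Marginalized host_m) (Visible a);
  host_s_arrow : arrow D' (Visible a) (Selected host_s)
}.

Section Absorption.
Variables (R : realType) (V : finType) (D D' : lsgraph V) (a : V).
Variable abs : absorption D D' a.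

Local Notation emb := (embed (emb_m abs) (emb_s abs)).
Local Notation me := (Marginalized (extra_m abs) : vertex D).
Local Notation se := (Selected (extra_s abs) : vertex D).
Local Notation mF := (Marginalized (host_m abs) : vertex D').
Local Notation sF := (Selected (host_s abs) : vertex D').

Lemma emb_inj : injective emb.
Proof.
by move=> [[v|m]|t] [[v'|m']|t'] //= [] => [->|/emb_m_inj ->|/emb_s_inj ->].
Qed.

Lemma emb_neq_me w : emb w != me.
Proof. by case: w => [[v|m]|t] //=; apply: contraNneq (extra_m_new abs m) => -[->]. Qed.

Lemma emb_neq_se w : emb w != se.
Proof. by case: w => [[v|m]|t] //=; apply: contraNneq (extra_s_new abs t) => -[->]. Qed.

Lemma emb_cover w : w != me -> w != se -> exists w', w = emb w'.
Proof.
case: w => [[v|m]|t] wm ws; first by exists (Visible v).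
- have [m' ->] : exists m', m = emb_m abs m'.
    by apply: emb_m_cover; apply: contraNneq wm => ->.
  by exists (Marginalized m').
- have [t' ->] : exists t', t = emb_s abs t'.
    by apply: emb_s_cover; apply: contraNneq ws => ->.
  by exists (Selected t').
Qed.

Definition unembed (w : vertex D) : option (vertex D') := [pick w' | emb w' == w].

Lemma embK w : unembed (emb w) = Some w.
Proof.
rewrite /unembed; case: pickP => [w' /eqP/emb_inj -> //|/(_ w)].
by rewrite eqxx.
Qed.

Lemma unembedK w w' : unembed w = Some w' -> emb w' = w.
Proof. by rewrite /unembed; case: pickP => // u /eqP <- [->]. Qed.

Lemma unembed_me : unembed me = None.
Proof. by rewrite /unembed; case: pickP => // w; rewrite (negbTE (emb_neq_me w)). Qed.

Lemma unembed_se : unembed se = None.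
Proof. by rewrite /unembed; case: pickP => // w; rewrite (negbTE (emb_neq_se w)). Qed.

Definition pull (x : config R (vertex D)) : config R (vertex D') := x \o emb.

Definition extend0 (x : config R (vertex D')) : config R (vertex D) :=
  fun w => if unembed w is Some w' then x w' else 0.

Lemma measurable_pull : measurable_fun setT pull.
Proof. by apply: measurable_config => w; exact: measurable_coord. Qed.

Lemma extend0K : cancel extend0 pull.
Proof. by move=> x; apply/funext => w; rewrite /pull /extend0 /= embK. Qed.

Lemma pull_update_se x r : pull [eta x with se |-> r] = pull x.
Proof. by apply/funext => w; rewrite /pull /= (negbTE (emb_neq_se w)). Qed.

Lemma extend0_update x w y :
  extend0 [eta x with w |-> y] = [eta extend0 x with emb w |-> y].
Proof.
apply/funext => u; rewrite /extend0 /=; case E : (unembed u) => [w'|].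
  by rewrite -(unembedK E) (inj_eq emb_inj).
by case: eqVneq E => // ->; rewrite embK.
Qed.

Lemma measurable_event_pull A : measurable A ->
  measurable_fun setT (fun x => (\1_(selection_event A) (pull x))%:E : \bar R).
Proof.
move=> mA; apply/measurable_EFinP.
apply: (measurableT_comp (measurable_indic (D := setT) _)).
  exact: measurable_selection_event.
exact: measurable_pull.
Qed.

Lemma selection_event_pull A x :
  selection_event A x <-> selection_event A (pull x) /\ x se = 0.
Proof.
split=> [[Ax x0]|[[Ax x0] xse]].
  by split=> //; split=> // t; exact: (x0 (emb_s abs t)).
split=> // t; have [->//|/eqP ts] := pselect (t = extra_s abs).
by have [t' ->] := emb_s_cover ts; exact: x0 t'.
Qed.

(** The extra vertices are frozen at 0, where they influence nothing. *)
Lemma absorption_expand kind :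
  @selected_model R V D' kind `<=` @selected_model R V D kind.
Proof.
move=> Q [Om' [k' [s' [[Om'k k'1] [par' topo'] det' mass0 massE]]]].
have mh : measurable_fun setT (fun p : config R (vertex D) * R => p.2).
  exact: measurable_snd.
have m0 : measurable_fun setT (fun _ : config R (vertex D) => 0 : R).
  exact: measurable_cst.
pose k w : R.-pker config R (vertex D) ~> R :=
  if unembed w is Some w' then transport (k' w') measurable_pull mh else kdirac m0.
have k_emb w x B : measurable B -> k (emb w) x B = k' w (pull x) B.
  by move=> mB; rewrite /k embK transportE.
have k_me x : k me x = \d_(0 : R) by rewrite /k unembed_me.
have k_se x : k se x = \d_(0 : R) by rewrite /k unembed_se.
have /topological_orderP[us' s'W irr' os'] := topo'.
pose Om w := if unembed w is Some w' then Om' w' else [set 0].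
pose s := me :: map emb s' ++ [:: se].
have mass A : measurable A -> selected_mass k s A = selected_mass k' s' A.
  move=> mA; rewrite /selected_mass.
  set F := fun x => _.
  have mE := measurable_selection_event (D := D) mA.
  have mF : measurable_fun setT F.
    by apply/measurable_EFinP; exact: measurable_indic.
  have F0 x : (0 <= F x)%E by rewrite lee_fin.
  have me0 B : measurable B -> k me (fun=> 0) B = \d_(0 : R) B by rewrite k_me.
  rewrite /s (iterated_dirac _ F0 mF me0) (update_same (fun=> 0) me) iterated_cat.
  have F1E x : iterated_integral k [:: se] F x = F [eta x with se |-> 0].
    by apply: (iterated_dirac [::] F0 mF) => B _; rewrite k_se.
  have -> : (fun=> 0) = extend0 (fun=> 0) :> config R (vertex D).
    by apply/funext => w; rewrite /extend0; case: unembed.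
  rewrite -(iterated_recode (k := k') (g := extend0) (h := fun=> id)) //.
  - apply: eq_iterated => // x.
    rewrite -[LHS]/(iterated_integral k [:: se] F (extend0 x)) F1E /F !indicE.
    congr (_%:R)%:E; congr nat_of_bool; apply/idP/idP; rewrite !inE.
      by move=> /selection_event_pull[]; rewrite pull_update_se extend0K.
    by move=> Ax; apply/selection_event_pull; rewrite pull_update_se extend0K /= eqxx.
  - by move=> x; exact: iterated_ge0.
  - exact: measurable_iterated.
  - by move=> w _ x y; exact: extend0_update.
  - move=> w _ x B mB; rewrite k_emb//; congr (k' w _ B).
    exact: extend0K.
exists Om, k, s; split.
- split=> [w|w x]; rewrite /Om /k; case E : unembed => [w'|] //.
  + by apply: state_space_finite; exact: finite_set1.
  + by rewrite transportE//; exact: measurable_state_space (Om'k w').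
  + by rewrite /= /kdirac /= diracE mem_set.
- split.
    move=> w x y xy B mB; rewrite /k; case E : unembed => [w'|] //.
    rewrite !transportE//; apply: par' => // u uw; apply: xy.
    by rewrite -(unembedK E) (emb_arrow abs).
  apply/topological_orderP; split.
  + rewrite /s /= mem_cat inE orbF cat_uniq map_inj_uniq//; last exact: emb_inj.
    rewrite us' /= orbF !andbT; apply/andP; split; apply/mapP => -[w _ /eqP].
      by rewrite eq_sym (negbTE (emb_neq_me w)).
    by rewrite eq_sym (negbTE (emb_neq_se w)).
  + move=> w; rewrite /s !inE mem_cat !inE.
    have [//|wm] := eqVneq w me; have [_|ws] := eqVneq w se; first by rewrite orbT.
    have [w' ->] := emb_cover wm ws.
    by rewrite map_f// s'W.
  + move=> w; have [->|wm] := eqVneq w me; first exact: (source_m abs).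
    have [->|ws] := eqVneq w se; first exact: (sink_s abs).
    by have [w' ->] := emb_cover wm ws; rewrite (emb_arrow abs) irr'.
  + rewrite /ordered /s /= pairwise_cat; apply/andP; split.
      by apply/allP => w _; rewrite (source_m abs).
    rewrite pairwise_map andbT; apply/andP; split.
      by apply/allrelP => u w _; rewrite inE => /eqP ->; rewrite (sink_s abs).
    by apply: sub_pairwise os' => u w /=; rewrite (emb_arrow abs).
- move=> v; have [f fE] := det' v; exists (f \o pull) => x B mB.
  by rewrite (k_emb (Visible v))// fE.
- by rewrite mass.
- by move=> A mA; rewrite !mass// massE.
Qed.

End Absorption.

Section Reduction.
Variables (R : realType) (V : finType) (D D' : lsgraph V) (a : V).
Variable abs : absorption D D' a.

Local Notation emb := (embed (emb_m abs) (emb_s abs)).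
Local Notation va := (Visible a).
Local Notation me := (Marginalized (extra_m abs) : vertex D).
Local Notation se := (Selected (extra_s abs) : vertex D).
Local Notation mF := (Marginalized (host_m abs) : vertex D').

Lemma emb_seq (q : seq (vertex D)) : me \notin q -> se \notin q ->
  exists t, q = map emb t.
Proof.
elim: q => [|w q IH]; first by exists [::].
rewrite !inE !negb_or => /andP[wm /IH qm] /andP[ws /qm[t ->]].
rewrite eq_sym in wm; rewrite eq_sym in ws.
by have [w' ->] := emb_cover wm ws; exists (w' :: t).
Qed.

(** The two sources come first and the extra selected vertex, which has no child,
    is sampled right after its last parent [a]; removing the extra vertices then
    leaves a topological order of [D']. *)
Lemma expose_order (k : vertex D -> R.-pker (config R (vertex D)) ~> R) s :
  (forall w, parental w (k w)) -> topological_order s ->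
  exists t1 t2, topological_order (mF :: t1 ++ va :: t2) /\
    forall F x, (forall x, 0 <= F x)%E -> measurable_fun setT F ->
      iterated_integral k s F x =
      iterated_integral k ((emb mF :: me :: map emb t1) ++ va :: se :: map emb t2) F x.
Proof.
move=> par /topological_orderP[us sW irr os].
have srcF v : arrow D v (emb mF) = false by exact: (source_m abs).
have srce v : arrow D v me = false by exact: (source_m abs).
have mFs : emb mF \in s by rewrite sW.
have [r1 [p1 sub1 e1]] := iterated_source par us os mFs srcF.
have ur1 : uniq (emb mF :: r1) by rewrite -(perm_uniq p1).
have mem1 w : w \in emb mF :: r1 by rewrite -(perm_mem p1) sW.
have mer1 : me \in r1.
  by have := mem1 me; rewrite inE eq_sym (negbTE (emb_neq_me _ _)).
have o1 : ordered r1 := subseq_pairwise sub1 os.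
have ur1' : uniq r1 by case/andP: ur1.
have [r2 [p2 sub2 e2]] := iterated_source par ur1' o1 mer1 srce.
have p12 : perm_eq s (emb mF :: me :: r2).
  by apply: perm_trans p1 _; rewrite perm_cons.
have u12 : uniq (emb mF :: me :: r2) by rewrite -(perm_uniq p12).
have mem2 w : w \in emb mF :: me :: r2 by rewrite -(perm_mem p12) sW.
have o2 : ordered r2 by exact: subseq_pairwise sub2 o1.
have ar2 : va \in r2 by have := mem2 va; rewrite !inE.
have sr2 : se \in r2 by have := mem2 se; rewrite !inE.
case/splitPr: ar2 e2 p12 u12 mem2 o2 sr2 {p2 sub2} => q1 q2 e2 p12 u12 mem2 o2 sr2.
have sq2 : se \in q2.
  move: sr2; rewrite mem_cat inE /= => /orP[sq1|//].
  move: o2; rewrite /ordered pairwise_cat => /andP[/allrelP/(_ se va sq1) + _].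
  by rewrite inE eqxx (extra_s_parents abs) eqxx => /(_ isT).
case/splitPr: sq2 e2 p12 u12 mem2 o2 {sr2} => q3 q4 e2 p12 u12 mem2 o2.
have consub w (l1 l2 : seq (vertex D)) : subseq l1 l2 -> subseq (w :: l1) (w :: l2).
  by rewrite /= eqxx.
have sub34 : subseq (emb mF :: q1 ++ va :: q3 ++ q4)
    (emb mF :: me :: q1 ++ va :: q3 ++ se :: q4).
  apply: (consub); apply: subseq_trans (subseq_cons _ me).
  by apply: cat_subseq => //; apply: (consub); apply: cat_subseq => //; exact: subseq_cons.
have /and3P[_ meN uq] := u12.
have useq : uniq (se :: (q1 ++ va :: q3) ++ q4).
  move: (permEl (perm_catCA (q1 ++ va :: q3) [:: se] q4)) => /perm_uniq <-.
  by rewrite -catA.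
have [seN uvq] : se \notin (q1 ++ va :: q3) ++ q4 /\ uniq ((q1 ++ va :: q3) ++ q4).
  by apply/andP; rewrite -cons_uniq.
move: meN seN; rewrite !(mem_cat, inE) !negb_or => /and4P[meq1 _ meq3 /andP[_ meq4]].
move=> /andP[/and3P[seq1 _ seq3] seq4].
have vaq3 : va \notin q3.
  move: uvq; rewrite -catA cat_uniq => /and3P[_ _]; rewrite cons_uniq.
  by rewrite mem_cat negb_or => /andP[/andP[]].
have [t1 q1E] := emb_seq meq1 seq1.
have [t2 q34E] : exists t, q3 ++ q4 = map emb t.
  by apply: emb_seq; rewrite mem_cat negb_or ?meq3 ?seq3.
exists t1, t2; split.
  have LE : map emb (mF :: t1 ++ va :: t2) = emb mF :: q1 ++ va :: q3 ++ q4.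
    by rewrite /= map_cat /= -q1E -q34E.
  apply/topological_orderP; split.
  - by rewrite -(map_inj_uniq (emb_inj (abs := abs))) LE (subseq_uniq sub34).
  - move=> w; rewrite -(mem_map (emb_inj (abs := abs))) LE.
    have := mem2 (emb w); rewrite !(inE, mem_cat).
    by rewrite (negbTE (emb_neq_me _ _)) (negbTE (emb_neq_se _ _)).
  - by move=> w; rewrite -(emb_arrow abs) irr.
  - have : ordered (map emb (mF :: t1 ++ va :: t2)).
      rewrite LE /ordered pairwise_cons; apply/andP; split.
        by apply/allP => v _; rewrite (source_m abs).
      move: o2; apply: subseq_pairwise.
      by apply: cat_subseq => //; apply: (consub); apply: cat_subseq => //; exact: subseq_cons.
    rewrite /ordered pairwise_map; apply: sub_pairwise => u w /=.
    by rewrite (emb_arrow abs).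
move=> F x F0 mFun; rewrite e1//.
apply: (@iterated_suffix _ _ _ k [:: emb mF] r1
  (me :: map emb t1 ++ va :: se :: map emb t2)) => {}x; rewrite e2// -q1E.
apply: (@iterated_suffix _ _ _ k (me :: q1) (va :: q3 ++ se :: q4)
  (va :: se :: map emb t2)) => {}x.
apply: (@iterated_suffix _ _ _ k [:: va] (q3 ++ se :: q4)
  (se :: map emb t2)) => {}x.
rewrite -q34E; apply: iterated_move => // v vq3; split.
- by apply: contraNneq seq3 => ->.
- apply: parental_ignores => //; rewrite (extra_s_parents abs) negb_or.
  by apply/andP; split; [apply: contraNneq vaq3 => <-|apply: contraNneq meq3 => <-].
- by apply: parental_ignores => //; rewrite (sink_s abs).
Qed.

End Reduction.

(** * Rejection sampling at the absorbed edge *)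

Section CoinSystem.
Variables (R : realType) (V : finType) (D D' : lsgraph V) (a : V).
Variable abs : absorption D D' a.

Local Notation emb := (embed (emb_m abs) (emb_s abs)).
Local Notation va := (Visible a : vertex D).
Local Notation me := (Marginalized (extra_m abs) : vertex D).
Local Notation se := (Selected (extra_s abs) : vertex D).
Local Notation sF := (Selected (host_s abs) : vertex D').
Local Notation WD := (config R (vertex D)).

Variables (k : vertex D -> R.-pker WD ~> R) (f : WD -> R) (Z : probability R R).
Variable c : R.
Hypotheses (par : forall w, parental w (k w)).
Hypothesis fE : forall x B, measurable B -> k va x B = \d_(f x) B.
Hypothesis ZE : forall p, 0 <= p <= 1 -> Z [set z | coin z p] = p%:E.

(** The probability that the extra selection succeeds once [a] has taken its value
    [f x]. *)
Definition accept (x : WD) : R := fine (k se [eta x with va |-> f x] [set 0]).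

(** The new mechanism of [a]: the coin stored at [extra_s] accepts the value [f x]
    with the probability [accept x] that the extra selection had; otherwise [a]
    raises an alarm by taking the exceptional value [c]. *)
Definition coin_value (x : WD) : R := if coin (x se) (accept x) then f x else c.

Lemma measurable_coin_value : measurable_fun setT coin_value.
Proof.
have mf : measurable_fun setT f := measurable_deterministic fE.
apply: measurable_fun_ifT => //.
have macc : measurable_fun setT accept.
  apply: measurableT_comp => //.
  apply: (measurableT_comp (measurable_kernel (k se) _ (measurable_set1 0))).
  by apply: measurable_update => //; exact: measurable_id.
exact: (measurableT_comp (@measurable_coin R)
  (measurable_fun_pair (measurable_coord se) macc)).
Qed.

(** The alarm is answered by the host selected vertex, which then takes the value 1
    and so leaves the event of selection. *)
Definition fail_value (p : WD * R) : R := if p.1 va == c then 1 else p.2.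

Lemma measurable_fail_value : measurable_fun setT fail_value.
Proof.
apply: measurable_fun_ifT => //; apply: measurable_fun_eqr => //.
exact: measurableT_comp (measurable_coord va) measurable_fst.
Qed.

Lemma measurable_cst_law U : measurable U -> measurable_fun setT (fun _ : WD => Z U).
Proof. by move=> _; exact: measurable_cst. Qed.

(** An intermediate system on the vertices of [D], where the place of the extra
    selected vertex is taken by the source [Z] of the coin.  It differs from the
    final system on [D'] only in that the three sources are still apart. *)
Definition coin_system (w : vertex D) : R.-pker WD ~> R :=
  if w == se then (law_kernel measurable_cst_law : R.-pker WD ~> R)
  else if w == va then (kdirac measurable_coin_value : R.-pker WD ~> R)
  else if w == emb sF then
    (transport (k w) (@measurable_id _ _ setT) measurable_fail_value :
      R.-pker WD ~> R)
  else k w.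

Lemma coin_system_se x B : coin_system se x B = Z B.
Proof. by rewrite /coin_system eqxx. Qed.

Lemma coin_system_va x B : coin_system va x B = \d_(coin_value x) B.
Proof. by rewrite /coin_system eqxx. Qed.

Lemma coin_system_sF x B : measurable B ->
  coin_system (emb sF) x B = k (emb sF) x [set r | B (fail_value (x, r))].
Proof. by move=> mB; rewrite /coin_system (negbTE (emb_neq_se _ _)) eqxx transportE. Qed.

Lemma coin_system_id w : w != se -> w != va -> w != emb sF -> coin_system w = k w.
Proof. by rewrite /coin_system => /negbTE -> /negbTE -> /negbTE ->. Qed.

Lemma coin_system_ext w (x y : WD) B : measurable B ->
  (forall u, arrow D u (emb w) -> x u = y u) ->
  (w = Visible a -> x me = y me /\ x se = y se) -> (w = sF -> x va = y va) ->
  coin_system (emb w) x B = coin_system (emb w) y B.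
Proof.
move=> mB xy xy_a xy_s.
have kxy C : measurable C -> k (emb w) x C = k (emb w) y C.
  by move=> mC; apply: par => // u uw; exact: xy.
have [wa|wa] := eqVneq w (Visible a).
  have [mxy exy] := xy_a wa; rewrite wa in kxy *.
  have fxy : f x = f y := deterministic_inj fE kxy.
  rewrite !coin_system_va /coin_value /accept exy fxy.
  suff -> : k se [eta x with va |-> f y] [set 0] =
      k se [eta y with va |-> f y] [set 0] by [].
  apply: par; last exact: measurable_set1.
  move=> u; rewrite (extra_s_parents abs) => /orP[]/eqP ->; last exact: mxy.
  by rewrite /= eqxx.
have [ws|ws] := eqVneq w sF.
  rewrite ws in kxy *; rewrite !coin_system_sF// /fail_value /= xy_s//; apply: kxy.
  rewrite -[X in measurable X]setTI.
  have m : measurable_fun setT (fun r => fail_value (y, r)).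
    exact: (measurableT_comp measurable_fail_value (pair1_measurable y)).
  exact: (m measurableT B mB).
rewrite coin_system_id ?kxy//; first exact: emb_neq_se.
  by rewrite -[va]/(emb (Visible a)) (inj_eq (emb_inj (abs := abs))).
by rewrite (inj_eq (emb_inj (abs := abs))).
Qed.

Section Tail.
Variables (A : set (config R V)) (t : seq (vertex D)).
Hypotheses (mA : measurable A) (ut : uniq t).
Hypotheses (tse : se \notin t) (tva : va \notin t) (tsF : emb sF \in t).

Let F (x : WD) : \bar R := (\1_(selection_event A) (pull abs x))%:E.

Let G (x : WD) : \bar R :=
  (\1_(selection_event (A `&` [set v | v a != c])) x)%:E.

Let mF : measurable_fun setT F.
Proof. exact: measurable_event_pull. Qed.

Let F0 x : (0 <= F x)%E. Proof. by rewrite lee_fin. Qed.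

Let mG : measurable_fun setT G.
Proof.
apply/measurable_EFinP; apply: measurable_indic.
apply: measurable_selection_event; apply: measurableI => //.
exact: measurable_coord_neq.
Qed.

Let G0 x : (0 <= G x)%E. Proof. by rewrite lee_fin. Qed.

Let GE x : G x = if (x va != c) && (x se == 0) then F x else 0%E.
Proof.
rewrite /G /F !indicE; case: ifPn => [/andP[xc /eqP x0]|nx].
  congr (_%:R)%:E; congr nat_of_bool; apply/idP/idP; rewrite !inE.
    by move=> /(selection_event_pull abs)[[[Ax _] y0] _].
  by move=> [Ax y0]; apply/(selection_event_pull abs).
rewrite memNset//.
move=> /(selection_event_pull abs)[[[_ xc] _] x0]; move: nx.
by rewrite x0 eqxx andbT => /negP; exact.
Qed.

Let Fse x r : F [eta x with se |-> r] = F x.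
Proof. by rewrite /F pull_update_se. Qed.

Let coin_system_tail z :
  iterated_integral coin_system t F z =
  if z va == c then 0%E else iterated_integral k t F z.
Proof.
case: eqVneq => [zc|zc].
  case/splitPr: t / tsF ut tva => p q; rewrite cat_uniq cons_uniq.
  move=> /and3P[_ _ /andP[sq _]]; rewrite mem_cat negb_or => /andP[vp _].
  rewrite iterated_cat -[RHS](iterated_cst coin_system p 0%E z).
  apply: (@eq_iterated_in _ _ _ (fun x => x va = c)) => // [w wp x y xc|x xc].
    by rewrite /= ifN//; apply: contraNneq vp => ->.
  have sF1 B : measurable B -> coin_system (emb sF) x B = \d_(1 : R) B.
    move=> mB; rewrite coin_system_sF// diracE.
    rewrite (_ : [set _ | _] = if 1 \in B then setT else set0).
      by case: ifP; rewrite ?prob_kernel ?measure0.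
    rewrite /fail_value /= xc eqxx.
    case: ifPn => [|/negP]; rewrite inE => B1; apply/seteqP; split => //.
  rewrite (iterated_dirac _ F0 mF sF1).
  rewrite -[RHS](iterated_cst coin_system q 0%E [eta x with emb sF |-> 1]).
  apply: (@eq_iterated_in _ _ _ (fun x => x (emb sF) = 1)) => //.
  - by move=> w wq u y us; rewrite -[RHS]us /= ifN//; apply: contraNneq sq => e; rewrite /= e.
  - move=> u u1; rewrite /F indicE memNset// => -[_ /(_ (host_s abs))].
    by rewrite /pull /= in u1 *; rewrite u1 => /eqP; rewrite oner_eq0.
  - by rewrite /= eqxx.
apply: (@eq_iterated_in _ _ _ (fun x => x va != c)) => // [w wt x y xc|w wt x B xc mB].
  by rewrite /= ifN//; apply: contraNneq tva => ->.
have wse : w != se by apply: contraNneq tse => <-.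
have wva : w != va by apply: contraNneq tva => <-.
have [->|wsF] := eqVneq w (emb sF); last by rewrite coin_system_id.
by rewrite coin_system_sF// /fail_value /= (negbTE xc).
Qed.

(** Both sides sample the pair ([a], [extra_s]) and then the later vertices [t].
    On the right, the extra selection keeps the value [f x] with probability
    [accept x]; on the left, the coin does.  Rejections have mass 0 on the left,
    because the alarm spoils the host selection, and the value [c] is excluded on
    the right by hand. *)
Lemma coin_system_selection x :
  iterated_integral coin_system (se :: va :: t) F x =
  iterated_integral k (va :: se :: t) G x.
Proof.
have kse w : ignores (k w) se.
  by apply: parental_ignores => //; rewrite (sink_s abs).
pose y := f x.
pose x1 : WD := [eta x with va |-> y].
(* the contribution of an accepted sample, for either system *)
pose C : \bar R := if y == c then 0%E else iterated_integral k t F x1.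
have C0 : (0 <= C)%E by rewrite /C; case: ifP => // _; exact: iterated_ge0.
have kseF r : iterated_integral k t F [eta x1 with se |-> r] = iterated_integral k t F x1.
  by apply: iterated_ignores.
have mS (S : set R) : measurable S -> measurable_fun setT (fun r => (\1_S r)%:E : \bar R).
  by move=> mS; apply/measurable_EFinP; exact: measurable_indic.
have fse n : f [eta x with se |-> n] = y.
  by apply: (deterministic_inj fE) => B mB; exact: kse.
have vase (u v : R) : [eta [eta x with se |-> u] with va |-> v] =
    [eta [eta x with va |-> v] with se |-> u] :> WD.
  exact: update_comm.
pose p := fine (k se x1 [set 0]).
have pE : p%:E = k se x1 [set 0].
  rewrite fineK// ge0_fin_numE//; apply: le_lt_trans (ltry 1).
  by rewrite -(prob_kernel (s := k se) x1); apply: le_measure; rewrite ?inE//; exact: measurable_set1.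
have acc n : accept [eta x with se |-> n] = p.
  by rewrite /accept fse vase kse//; exact: measurable_set1.
have mcoin : measurable [set z : R | coin z p].
  rewrite -[X in measurable X]setTI.
  have m : measurable_fun setT (fun z : R => coin z p).
    exact: (measurableT_comp (@measurable_coin R) (pair2_measurable p)).
  exact: (m measurableT [set true]).
transitivity (C * p%:E)%E.
  transitivity (\int[Z]_n (C * (\1_[set z | coin z p] n)%:E))%E; last first.
    rewrite ge0_integralZl//; last exact: mS.
    congr (C * _)%E; apply: etrans (_ : _ = Z [set z | coin z p]) _.
      by rewrite integral_indic ?setIT.
    apply: ZE.
    rewrite -!lee_fin pE measure_ge0 -(prob_kernel (s := k se) x1).
    by apply: le_measure; rewrite ?inE//; exact: measurable_set1.
  rewrite -[LHS]/(\int[coin_system se x]_n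
    iterated_integral coin_system (va :: t) F [eta x with se |-> n])%E.
  rewrite (eq_measure_integral Z) => [|B mB _]; last exact: coin_system_se.
  apply: eq_integral => n _.
  rewrite (iterated_dirac _ F0 mF (fun B _ => coin_system_va _ B)) coin_system_tail.
  have -> : coin_value [eta x with se |-> n] = if coin n p then y else c.
    by rewrite /coin_value /= eqxx acc fse.
  have vaE (u : WD) v : [eta u with va |-> v] va = v by rewrite /= eqxx.
  rewrite vaE indicE; have [co|co] := boolP (coin n p).
    by rewrite mem_set// mule1 vase kseF.
  by rewrite eqxx memNset ?mule0//; exact/negP.
transitivity (\int[k se x1]_r (C * (\1_[set 0] r)%:E))%E.
  rewrite ge0_integralZl//; last by apply: mS; exact: measurable_set1.
  by rewrite integral_indic ?setIT ?pE//; exact: measurable_set1.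
rewrite (iterated_dirac _ G0 mG (fE x)) -/y -/x1 /=.
apply: eq_integral => r _; rewrite /C indicE.
have Gz z : z va = c \/ z se != 0 -> iterated_integral k t G z = 0%E.
  move=> zP; rewrite -[RHS](iterated_cst k t 0%E z).
  apply: (@eq_iterated_in _ _ _ (fun x => x va = c \/ x se != 0)) => //.
  - move=> w wt u v up; rewrite /= !ifN//; first by apply: contraNneq tse => ->.
    by apply: contraNneq tva => ->.
  - move=> u [uc|u0]; rewrite GE; first by rewrite uc eqxx.
    by rewrite (negbTE u0) andbF.
have [yc|yc] := eqVneq y c.
  by rewrite mul0e Gz//; left; rewrite /= /x1 /= eqxx.
have [->|r0] := eqVneq r 0; last first.
  rewrite memNset ?mule0; last exact/eqP.
  by rewrite Gz//; right; rewrite /= eqxx.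
rewrite mem_set// mule1 -(kseF 0).
apply: (@eq_iterated_in _ _ _ (fun x => x va != c /\ x se = 0)) => //.
- move=> w wt u v up; rewrite /= !ifN//; first by apply: contraNneq tse => ->.
  by apply: contraNneq tva => ->.
- by move=> u [uc u0]; rewrite GE uc u0 eqxx.
- by split; rewrite /= ?/x1 /= eqxx.
Qed.

End Tail.

End CoinSystem.

(** * Packing the sources into the host *)

Lemma probability_superset d (T : measurableType d) (R : realType)
    (mu : {measure set T -> \bar R}) (A B : set T) : measurable A -> measurable B ->
  mu setT = 1%E -> mu A = 1%E -> A `<=` B -> mu B = 1%E.
Proof.
move=> mA mB mT A1 AB; apply: le_anti; apply/andP; split.
  by rewrite -mT; apply: le_measure; rewrite ?inE.
by rewrite -A1; apply: le_measure; rewrite ?inE.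
Qed.

Section Spread.
Variables (R : realType) (V : finType) (D D' : lsgraph V) (a : V).
Variable abs : absorption D D' a.

Local Notation emb := (embed (emb_m abs) (emb_s abs)).
Local Notation va := (Visible a).
Local Notation me := (Marginalized (extra_m abs) : vertex D).
Local Notation se := (Selected (extra_s abs) : vertex D).
Local Notation mF := (Marginalized (host_m abs) : vertex D').
Local Notation sF := (Selected (host_s abs) : vertex D').
Local Notation WD := (config R (vertex D)).
Local Notation WD' := (config R (vertex D')).

(** The configuration of [D] coded by one of [D']: the value of the host holds the
    values of the host itself, of [extra_m] and of the source of the coin, the last
    one being stored at [extra_s]. *)
Definition unpack (x : WD') : WD := fun w =>
  if unembed abs w is Some w' then
    if w' == mF then decode1 (x mF) else x w'
  else if w == me then decode1 (decode2 (x mF)) else decode2 (decode2 (x mF)).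

Lemma unpack_mF x : unpack x (emb mF) = decode1 (x mF).
Proof. by rewrite /unpack embK eqxx. Qed.

Lemma unpack_me x : unpack x me = decode1 (decode2 (x mF)).
Proof. by rewrite /unpack unembed_me eqxx. Qed.

Lemma unpack_se x : unpack x se = decode2 (decode2 (x mF)).
Proof. by rewrite /unpack unembed_se. Qed.

Lemma unpack_emb x w : w != mF -> unpack x (emb w) = x w.
Proof. by move=> wF; rewrite /unpack embK (negbTE wF). Qed.

Lemma measurable_unpack : measurable_fun setT unpack.
Proof.
apply: measurable_config => w; rewrite /unpack.
have d1 := @measurable_decode1 R; have d2 := @measurable_decode2 R.
have mx := measurable_coord (R := R) mF.
case: (unembed abs w) => [w'|].
  by case: (w' == mF); [exact: (measurableT_comp d1 mx)|exact: measurable_coord].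
by case: (w == me); [exact: (measurableT_comp d1 (measurableT_comp d2 mx))|
  exact: (measurableT_comp d2 (measurableT_comp d2 mx))].
Qed.

Lemma unpack_update x w y : w != mF ->
  unpack [eta x with w |-> y] = [eta unpack x with emb w |-> y].
Proof.
move=> wF; have FwF : (mF == w) = false by rewrite eq_sym (negbTE wF).
apply/funext => u /=; rewrite /unpack /= FwF.
case E : (unembed abs u) => [u'|].
  rewrite -(unembedK E) (inj_eq (emb_inj (abs := abs))).
  by case: (eqVneq u' w) => [->|//]; rewrite (negbTE wF).
by case: (eqVneq u (emb w)) E => // ->; rewrite embK.
Qed.

Lemma unpack_encode x u v n :
  unpack [eta x with mF |-> encode u (encode v n)] =
  [eta [eta [eta extend0 abs x with emb mF |-> u] with me |-> v] with se |-> n].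
Proof.
apply/funext => w.
have [->|ws] := eqVneq w se.
  by rewrite unpack_se /= !eqxx !encodeK2.
have [->|wm] := eqVneq w me.
  by rewrite unpack_me /= !eqxx encodeK2 encodeK1.
have [w' wE] := emb_cover wm ws; rewrite /= (negbTE ws) (negbTE wm) wE.
rewrite -[inl (inr (emb_m _ _))]/(emb mF) (inj_eq (emb_inj (abs := abs))).
case: (eqVneq w' mF) => [->|w'F].
  by rewrite unpack_mF /= eqxx encodeK1.
by rewrite unpack_emb//= (negbTE w'F) /extend0 embK.
Qed.

Lemma selection_event_unpack A x :
  selection_event A (pull abs (unpack x)) = selection_event A x.
Proof.
have vis : visible_part (pull abs (unpack x)) = visible_part x.
  by apply/funext => v; exact: (unpack_emb x (w := Visible v)).
by rewrite /selection_event /= vis; congr (_ /\ _); apply/propext; split=> x0 t;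
  have := x0 t; rewrite /pull /= (unpack_emb x (w := Selected t)).
Qed.

(** Decoding respects parenthood: whatever a vertex could read off [extra_m] it reads
    off the host. *)
Lemma unpack_parents x y w :
  (forall u, arrow D' u w -> x u = y u) ->
  forall u, arrow D u (emb w) -> unpack x u = unpack y u.
Proof.
move=> xy u uw.
have [us|us] := eqVneq u se.
  by exfalso; move: uw; rewrite us (sink_s abs).
have [um|um] := eqVneq u me.
  have Fw : arrow D' mF w by apply: extra_m_children; rewrite -um.
  by rewrite um !unpack_me xy.
have [u' uE] := emb_cover um us; move: uw; rewrite uE (emb_arrow abs) => uw.
have [u'F|u'F] := eqVneq u' mF; last by rewrite !unpack_emb// xy.
by rewrite u'F !unpack_mF xy// -u'F.
Qed.

Lemma unpack_extra x y :
  (forall u, arrow D' u va -> x u = y u) ->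
  unpack x me = unpack y me /\ unpack x se = unpack y se.
Proof. by move=> xy; rewrite !unpack_me !unpack_se !(xy mF)//; exact: host_m_arrow. Qed.

End Spread.

(* Unification must not try to compare two decoded configurations by computation. *)
#[local] Opaque unpack.

Section Reduce.
Variables (R : realType) (V : finType) (D D' : lsgraph V) (a : V).
Variable abs : absorption D D' a.

Local Notation emb := (embed (emb_m abs) (emb_s abs)).
Local Notation va := (Visible a).
Local Notation mF := (Marginalized (host_m abs) : vertex D').
Local Notation WD := (config R (vertex D)).
Local Notation WD' := (config R (vertex D')).

Variables (k : vertex D -> R.-pker WD ~> R) (f : WD -> R) (Z P3 : probability R R).
Variable c : R.
Hypotheses (par : forall w, parental w (k w)).
Hypothesis fE : forall x B, measurable B -> k va x B = \d_(f x) B.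

Local Notation mix := (coin_system abs Z c fE).

Let measurable_cst_P3 U : measurable U -> measurable_fun setT (fun _ : WD' => P3 U).
Proof. by move=> _; exact: measurable_cst. Qed.

Let mh : measurable_fun setT (fun p : WD' * R => p.2).
Proof. exact: measurable_snd. Qed.

Definition reduced (w : vertex D') : R.-pker WD' ~> R :=
  if w == mF then (law_kernel measurable_cst_P3 : R.-pker WD' ~> R)
  else (transport (mix (emb w)) (@measurable_unpack R V D D' a abs) mh :
    R.-pker WD' ~> R).

Lemma reduced_mF x B : reduced mF x B = P3 B.
Proof. by rewrite /reduced eqxx. Qed.

Lemma reduced_emb w x B : w != mF -> measurable B ->
  reduced w x B = mix (emb w) (unpack abs x) B.
Proof. by move=> /negbTE wF mB; rewrite /reduced wF transportE. Qed.

Lemma parental_reduced w : parental w (reduced w).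
Proof.
move=> x y xy B mB.
have [->|wF] := eqVneq w mF; first by rewrite !reduced_mF.
apply: etrans (reduced_emb x wF mB) _; apply/esym.
apply: etrans (reduced_emb y wF mB) _; apply/esym.
apply: (coin_system_ext Z c par fE mB) => [|wa|ws].
- exact: unpack_parents.
- by apply: unpack_extra; rewrite -wa.
- apply: etrans (unpack_emb (abs := abs) x (w := va) isT) _; apply/esym.
  apply: etrans (unpack_emb (abs := abs) y (w := va) isT) _; apply/esym.
  by apply: xy; rewrite ws; exact: host_s_arrow.
Qed.

End Reduce.

Section ReducedMass.
Variables (R : realType) (V : finType) (D D' : lsgraph V) (a : V).
Variable abs : absorption D D' a.

Local Notation emb := (embed (emb_m abs) (emb_s abs)).
Local Notation va := (Visible a).
Local Notation me := (Marginalized (extra_m abs) : vertex D).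
Local Notation se := (Selected (extra_s abs) : vertex D).
Local Notation mF := (Marginalized (host_m abs) : vertex D').
Local Notation sF := (Selected (host_s abs) : vertex D').
Local Notation WD := (config R (vertex D)).
Local Notation WD' := (config R (vertex D')).

Variables (k : vertex D -> R.-pker WD ~> R) (f : WD -> R) (Z P2 P3 : probability R R).
Variable c : R.
Hypotheses (par : forall w, parental w (k w)).
Hypothesis fE : forall x B, measurable B -> k va x B = \d_(f x) B.
Hypothesis ZE : forall p, 0 <= p <= 1 -> Z [set z | coin z p] = p%:E.
Let muF := kernel_law (k (emb mF)) (fun=> 0).
Let muE := kernel_law (k me) (fun=> 0).
Hypothesis P2E : forall g : R -> \bar R,
  measurable_fun setT g -> (forall z, 0 <= g z)%E ->
  (\int[P2]_z g z = \int[muE]_u \int[Z]_v g (encode u v))%E.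
Hypothesis P3E : forall g : R -> \bar R,
  measurable_fun setT g -> (forall z, 0 <= g z)%E ->
  (\int[P3]_z g z = \int[muF]_u \int[P2]_v g (encode u v))%E.

Local Notation mix := (coin_system abs Z c fE).
Local Notation red := (reduced abs Z P3 c fE).

Variables (A : set (config R V)) (t1 t2 : seq (vertex D')).
Hypothesis mA : measurable A.
Hypothesis topo : topological_order (mF :: t1 ++ va :: t2).

Let F (x : WD) : \bar R := (\1_(selection_event A) (pull abs x))%:E.

Let measurable_F : measurable_fun setT F.
Proof. exact: measurable_event_pull. Qed.

Let F0 x : (0 <= F x)%E. Proof. by rewrite lee_fin. Qed.

Let before_a w : w \in t1 -> w != va /\ w != sF.
Proof.
have [ut _ _ ot] := (topological_orderP _).1 topo => wt; split.
  move: ut; rewrite cons_uniq cat_uniq cons_uniq => /andP[_ /and3P[_ + _]].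
  by move=> /hasPn/(_ va (mem_head _ _)); apply: contraNneq => <-.
move: ot; rewrite /ordered pairwise_cons pairwise_cat => /andP[_ /andP[+ _]].
move=> /allrelP/(_ w va wt); rewrite mem_head => /(_ isT).
by apply: contraNneq => ->; exact: host_s_arrow.
Qed.

Let coin_system_prefix w : w \in emb mF :: me :: map emb t1 -> mix w = k w.
Proof.
rewrite !inE => /or3P[/eqP ->|/eqP ->|/mapP[w' /before_a[wa ws] ->]].
- by rewrite coin_system_id.
- by rewrite coin_system_id// eq_sym emb_neq_me.
- apply: coin_system_id; first exact: emb_neq_se.
    by rewrite -[va]/(emb va) (inj_eq (emb_inj (abs := abs))).
  by rewrite (inj_eq (emb_inj (abs := abs))).
Qed.

Let coin_system_source w x B : measurable B -> w = emb mF \/ w = me ->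
  mix w x B = k w (fun=> 0) B.
Proof.
move=> mB wP; rewrite coin_system_prefix; last first.
  by case: wP => ->; rewrite !inE eqxx ?orbT.
by apply: par => // u; case: wP => ->; rewrite (source_m abs).
Qed.

(** Integrating over the code held by the host is integrating over its three
    components. *)
Let reduced_coin_system :
  selected_mass red (mF :: t1 ++ va :: t2) A =
  iterated_integral mix (emb mF :: me :: se :: map emb (t1 ++ va :: t2)) F (fun=> 0).
Proof.
have [ut _ _ _] := (topological_orderP _).1 topo.
have mFt : mF \notin t1 ++ va :: t2 by case/andP: ut.
pose H := iterated_integral mix (map emb (t1 ++ va :: t2)) F.
have H0 z : (0 <= H z)%E by exact: iterated_ge0.
have mH : measurable_fun setT H by exact: measurable_iterated.
have step x : iterated_integral red (t1 ++ va :: t2)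
    (fun y => (\1_(selection_event A) y)%:E) x = H (unpack abs x).
  rewrite /H -(iterated_recode (k := red) (h := fun=> id) (g := unpack abs)) //.
  - apply: eq_iterated => // y; rewrite /F /=; congr (_%:E); rewrite !indicE.
    congr (_ %:R); congr nat_of_bool; apply/idP/idP; rewrite !inE selection_event_unpack//.
  - move=> w wt y z; apply: unpack_update; apply: contraNneq mFt => <- //.
  - move=> w wt y B mB; apply/esym; apply: reduced_emb => //.
    by apply: contraNneq mFt => <-.
pose g u v n := H [eta [eta [eta (fun=> 0) with emb mF |-> u] with me |-> v] with se |-> n].
pose h z := H (unpack abs [eta (fun=> 0) with mF |-> z]).
have mh : measurable_fun setT h.
  apply: (measurableT_comp mH); apply: (measurableT_comp (@measurable_unpack _ _ _ _ _ abs)).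
  by apply: measurable_update => //; exact: measurable_cst.
have hE u v n : h (encode u (encode v n)) = g u v n.
  rewrite /h unpack_encode /g; congr (H _); apply/funext => w.
  by rewrite /=; case: ifP => // _; case: ifP => // _; case: ifP => // _;
    rewrite /extend0; case: unembed.
transitivity (\int[P3]_z h z)%E.
  rewrite /selected_mass /=.
  rewrite (eq_measure_integral P3) => [|B mB _]; last by rewrite reduced_mF.
  by apply: eq_integral => z _; rewrite step.
have h0 z : (0 <= h z)%E by exact: H0.
apply: etrans (P3E mh h0) _.
have menc (u : R) : measurable_fun setT (fun v => encode u v).
  have mu : measurable_fun setT (fun v : R => (u, v)).
    by apply: measurable_fun_pair => //; exact: measurable_cst.
  exact: (measurableT_comp (@measurable_encode R) mu).
transitivity (\int[muF]_u \int[muE]_v \int[Z]_n g u v n)%E.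
  apply: eq_integral => u _.
  have hu0 v : (0 <= h (encode u v))%E by exact: H0.
  apply: etrans (P2E (measurableT_comp mh (menc u)) hu0) _.
  by apply: eq_integral => v _; apply: eq_integral => n _; exact: hE.
rewrite /=.
rewrite [RHS](eq_measure_integral muF) => [|B mB _]; last first.
  by apply: coin_system_source => //; left.
apply: eq_integral => u _.
rewrite [RHS](eq_measure_integral muE) => [|B mB _]; last first.
  by apply: coin_system_source => //; right.
apply: eq_integral => v _.
by rewrite [RHS](eq_measure_integral Z) => [|B mB _]; last exact: coin_system_se.
Qed.

(** The coin is private to [a], so its source can be moved from the front to the
    place just before [a], where the two systems are compared by the one-step
    identity for the pair ([a], [extra_s]). *)
Lemma reduced_mass :
  selected_mass red (mF :: t1 ++ va :: t2) A =
  iterated_integral k ((emb mF :: me :: map emb t1) ++ va :: se :: map emb t2)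
    (fun x => (\1_(selection_event (A `&` [set v | v a != c])) x)%:E) (fun=> 0).
Proof.
have [ut mem_t _ _] := (topological_orderP _).1 topo.
have ue : uniq (map emb (mF :: t1 ++ va :: t2)).
  by rewrite (map_inj_uniq (emb_inj (abs := abs))).
have nse t : se \notin map emb t.
  by apply/mapP => -[w _ /esym/eqP]; rewrite (negbTE (emb_neq_se _ _)).
rewrite reduced_coin_system.
have -> : emb mF :: me :: se :: map emb (t1 ++ va :: t2) =
    [:: emb mF; me] ++ se :: map emb t1 ++ va :: map emb t2 by rewrite map_cat.
transitivity (iterated_integral mix
    ((emb mF :: me :: map emb t1) ++ se :: va :: map emb t2) F (fun=> 0)).
  apply: (@iterated_suffix _ _ _ _ [:: emb mF; me] _
    (map emb t1 ++ se :: va :: map emb t2)) => x.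
  apply/esym; apply: iterated_move => // v vt; split.
  - by apply: contraNneq (nse t1) => ->.
  - by move=> y r B mB; apply: etrans (coin_system_se _ _ _ _ _ _) (esym (coin_system_se _ _ _ _ _ _)).
  - rewrite coin_system_prefix; last by rewrite !inE vt !orbT.
    by apply: parental_ignores => //; rewrite (sink_s abs).
rewrite !iterated_cat; apply: eq_iterated => [w wt x B mB|x].
  by rewrite coin_system_prefix.
move: ue; rewrite map_cons map_cat map_cons cons_uniq cat_uniq cons_uniq.
move=> /andP[_ /and4P[_ _ vat2 ut2]].
apply: coin_system_selection => //.
apply: map_f; have := mem_t sF; rewrite inE mem_cat inE /= => /orP[|//].
by move=> /before_a[_]; rewrite eqxx.
Qed.

End ReducedMass.

Section AbsorptionModel.
Variables (R : realType) (V : finType) (D D' : lsgraph V) (a : V).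
Variable abs : absorption D D' a.

Local Notation emb := (embed (emb_m abs) (emb_s abs)).
Local Notation va := (Visible a).
Local Notation me := (Marginalized (extra_m abs) : vertex D).
Local Notation se := (Selected (extra_s abs) : vertex D).
Local Notation mF := (Marginalized (host_m abs) : vertex D').
Local Notation sF := (Selected (host_s abs) : vertex D').
Local Notation WD := (config R (vertex D)).
Local Notation WD' := (config R (vertex D')).

(** The alarm value [c] is chosen so that [X_a = c] has probability 0 under the given
    law; forbidding it then costs nothing. *)
Lemma absorption_reduce kind :
  @selected_model R V D kind `<=` @selected_model R V D' kind.
Proof.
move=> Q [Om [k [s [[Omk k1] [par topo] det mass0 massE]]]].
have [f fE] := det a.
have [Z [Znat ZE]] := coin_law R.
pose coord_a : {mfun config R V >-> R} := HB.pack (fun v : config R V => v a)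
  (isMeasurableFun.Build _ _ _ _ _ (measurable_coord a)).
have [c Qc] := null_value (distribution Q coord_a).
have [P2 [P2E P2C]] := pair_law (kernel_law (k me) (fun=> 0)) Z.
have [P3 [P3E P3C]] := pair_law (kernel_law (k (emb mF)) (fun=> 0)) P2.
have [t1 [t2 [topo' massk]]] := expose_order abs par topo.
have [S2 sS2 S2P] := state_space_encode (Omk me) (state_space_range R kind).
have [S3 sS3 S3P] := state_space_encode (Omk (emb mF)) sS2.
(* the two new values are the alarm [c] and the response 1 to it *)
pose Om' w := if w == mF then S3 else if w == va then Om va `|` [set c]
  else if w == sF then Om (emb sF) `|` [set 1] else Om (emb w).
have Om'k w : state_space kind (Om' w).
  rewrite /Om'; case: ifP => _ //; case: ifP => _; first exact: state_space_setU1.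
  by case: ifP => _ //; exact: state_space_setU1.
have mass A : measurable A ->
    selected_mass (reduced abs Z P3 c fE) (mF :: t1 ++ va :: t2) A = selected_mass k s A.
  move=> mA; have mAc : measurable (A `&` [set v | v a != c]).
    by apply: measurableI => //; exact: measurable_coord_neq.
  have -> : selected_mass k s A = selected_mass k s (A `&` [set v | v a != c]).
    rewrite (massE _ mA) (massE _ mAc); congr (_ * _)%E.
    have mc : measurable [set v : config R V | v a = c].
      exact: (measurable_coord_set a (measurable_set1 c)).
    apply/eqP; rewrite eq_le; apply/andP; split; last first.
      by apply: le_measure; rewrite ?inE.
    rewrite -[leRHS]adde0 -[X in (_ <= _ + X)%E]Qc.
    apply: le_trans (measureU2 _ mAc mc); apply: le_measure; rewrite ?inE//.
      exact: measurableU.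
    by move=> v Av; have [vc|vc] := eqVneq (v a) c; [right|left].
  apply: etrans (reduced_mass c par fE ZE P2E P3E mA topo') _.
  apply/esym; apply: massk => [x|]; first by rewrite lee_fin.
  by apply/measurable_EFinP; apply: measurable_indic; exact: measurable_selection_event.
exists Om', (reduced abs Z P3 c fE), (mF :: t1 ++ va :: t2); split.
- split=> // w x; have mOw := measurable_state_space (Om'k w).
  have [wF|wF] := eqVneq w mF.
    rewrite wF in mOw *; apply: etrans (reduced_mF _ _ _ _ _ _ _) _.
    rewrite /Om' eqxx.
    apply: (P3C (Om (emb mF)) S2) => //.
    + exact: measurable_state_space (Omk _).
    + exact: measurable_state_space sS2.
    + exact: measurable_state_space sS3.
    + exact: k1.
    + apply: (P2C (Om me) (range (fun n => n%:R))) => //.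
      * exact: measurable_state_space (Omk _).
      * exact: measurable_state_space (state_space_range R kind).
      * exact: measurable_state_space sS2.
      * exact: k1.
  apply: etrans (reduced_emb _ _ _ _ _ wF mOw) _; rewrite /Om' (negbTE wF).
  move: (unpack abs x) => y; rewrite /Om' (negbTE wF) in mOw *.
  have [wa|wa] := eqVneq w va.
    rewrite wa eqxx in mOw *; apply: etrans (coin_system_va _ _ _ _ _ _) _.
    rewrite diracE mem_set// /coin_value; case: ifP => _; [left|by right].
    have := k1 va y; rewrite fE ?diracE; last exact: measurable_state_space (Omk _).
    by case: (boolP (f y \in _)) => [|_ /eqP]; rewrite ?inE// eqe eq_sym oner_eq0.
  rewrite (negbTE wa) in mOw *; have [ws|ws] := eqVneq w sF.
    rewrite ws eqxx in mOw *; apply: etrans (coin_system_sF _ _ _ _ _ mOw) _.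
    have mB : measurable [set r | (Om (emb sF) `|` [set 1]) (fail_value a c (y, r))].
      have m : measurable_fun setT (fun r => fail_value a c (y, r)).
        exact: (measurableT_comp (measurable_fail_value a c) (pair1_measurable y)).
      by rewrite -[X in measurable X]setTI; exact: (m measurableT _ mOw).
    apply: (probability_superset (A := Om (emb sF))) => //.
    - exact: measurable_state_space (Omk _).
    - exact: prob_kernel.
    - by move=> r Or; rewrite /= /fail_value /=; case: ifP => _; [right|left].
  rewrite coin_system_id; first exact: k1.
  - exact: emb_neq_se.
  - by rewrite -[va]/(emb va) (inj_eq (emb_inj (abs := abs))).
  - by rewrite (inj_eq (emb_inj (abs := abs))).
- split; first exact: parental_reduced.
  exact: topo'.
- move=> v; have [f' f'E] := det v.
  have [->|va_] := eqVneq v a.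
    exists (coin_value abs k f c \o @unpack R V D D' a abs) => x B mB.
    apply: etrans (reduced_emb _ _ _ _ _ (w := va) isT mB) _.
    exact: coin_system_va.
  exists (f' \o @unpack R V D D' a abs) => x B mB.
  apply: etrans (reduced_emb _ _ _ _ _ (w := Visible v) isT mB) _.
  rewrite coin_system_id; first exact: f'E.
  - exact: (emb_neq_se abs (Visible v)).
  - by apply: contraNneq va_ => -[->].
  - by [].
- by rewrite mass.
- by move=> A mA; rewrite !mass// massE.
Qed.

End AbsorptionModel.

(** * Removing an edge of an smDG *)

Lemma absorption_acyclic (V : finType) (D D' : lsgraph V) (a : V) :
  absorption D D' a -> acyclic (arrow D) -> acyclic (arrow D').
Proof.
move=> abs acD c; rewrite -(mono_cycle (emb_arrow abs)) => /acD.
by case: c.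
Qed.

Section RemoveEdge.
Variables (V : finType) (G : smDG V) (a b : V) (Vs Vm : {set V}).
Hypotheses (ab : (a, b) \in edges G).
Hypotheses (sVs : Vs \in faces (sel G)) (aVs : a \in Vs).
Hypotheses (mVm : Vm \in faces (marg G)) (bVm : b \in Vm) (aVm : a \in Vm).

Let G' := remove_edge G (a, b).

Lemma special_ab : special G (a, b).
Proof.
by apply/and3P; split=> //=; apply/finset.bigcupP; [exists Vs|exists Vm].
Qed.

Lemma special_remove e : special G' e = (e != (a, b)) && special G e.
Proof. by rewrite /special /= finset.in_setD1 -andbA. Qed.

Lemma special_lift e : special G' e -> special G e.
Proof. by rewrite special_remove => /andP[]. Qed.

Definition lift_m (m : mvert (can G')) : mvert (can G) :=
  match m with
  | inl e => inl (exist _ (val e) (special_lift (valP e)))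
  | inr F => inr F
  end.

Definition lift_s (t : svert (can G')) : svert (can G) :=
  match t with
  | inl e => inl (exist _ (val e) (special_lift (valP e)))
  | inr F => inr F
  end.

Definition edge_ab : {e : V * V | special G e} := exist _ (a, b) special_ab.

(** The hosts are a maximal marginalized face through [a] and [b] and a maximal
    selected face through [a]. *)
Lemma remove_edge_absorption : absorption (can G) (can G') a.
Proof.
have [Fm maxFm VmF] := maxset_exists mVm.
have [Fs maxFs VsF] := maxset_exists sVs.
have val_ab (e : {e : V * V | special G' e}) : val e != (a, b).
  by have := valP e; rewrite special_remove => /andP[].
apply: (@Absorption V (can G) (can G') a lift_m lift_s (inl edge_ab) (inl edge_ab)
  (inr (exist _ Fm maxFm)) (inr (exist _ Fs maxFs))).
- by move=> [e|F] [e'|F'] //= [] => [/val_inj ->|->].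
- by move=> [e|F] [e'|F'] //= [] => [/val_inj ->|->].
- by move=> [e|F] //=; apply: contraNneq (val_ab e) => -[eE]; exact/eqP.
- by move=> [e|F] //=; apply: contraNneq (val_ab e) => -[eE]; exact/eqP.
- move=> [e|F] eab; last by exists (inr F).
  have e' : special G' (val e).
    rewrite special_remove (valP e) andbT; apply: contraNneq eab => eE.
    by apply/eqP; congr inl; apply: val_inj.
  by exists (inl (exist _ (val e) e')); congr inl; apply: val_inj.
- move=> [e|F] eab; last by exists (inr F).
  have e' : special G' (val e).
    rewrite special_remove (valP e) andbT; apply: contraNneq eab => eE.
    by apply/eqP; congr inl; apply: val_inj.
  by exists (inl (exist _ (val e) e')); congr inl; apply: val_inj.
- move=> [[v|[e|F]]|[e|F]] [[w|[e'|F']]|[e'|F']] //=.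
  rewrite -/G' special_remove finset.in_setD1; case: (eqVneq (v, w) (a, b)) => //= ->.
  by rewrite special_ab andbF.
- by move=> t [[w|m]|t'].
- by move=> [[u|[e|F]]|t] [e'|F'].
- move=> [[u|[e|F]]|t] //=; first by rewrite orbF.
- move=> [[w|[e|F]]|[e|F]] //=.
    by move=> /eqP ->; exact: (fintype.subsetP VmF).
  by move=> /eqP/(congr1 val) e_ab; case/eqP: (val_ab e); exact: esym e_ab.
- exact: (fintype.subsetP VmF).
- exact: (fintype.subsetP VsF).
Qed.

End RemoveEdge.

Theorem proposition9 (R : realType) (kind : space_kind) (V : finType)
    (G : smDG V) (a b : V) (Vs Vm : {set V}) :
  liftable G ->
  (a, b) \in edges G ->
  Vs \in faces (sel G) -> a \in Vs ->
  Vm \in faces (marg G) -> b \in Vm ->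
  a \in Vm ->
  observationally_equivalent R kind G (remove_edge G (a, b)).
Proof.
move=> liftG ab sVs aVs mVm bVm aVm.
have abs := remove_edge_absorption ab sVs aVs mVm bVm aVm.
split=> //; first exact: absorption_acyclic abs liftG.
have sinkG H t w : arrow (can (V := V) H) (Selected t) w = false by case: w => [[]|].
rewrite (smo_modelE R kind (sinkG G)) (smo_modelE R kind (sinkG _)).
apply/seteqP; split.
- exact: absorption_reduce abs kind.
- exact: absorption_expand abs kind.
Qed.
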